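(* Consider the interconnected system described in the context, with a partition $\{1,\dots,n\}=I_\Sigma\cup I_{\max}$. Assume each subsystem is input-to-state stable (ISS) in the mixed sense, i.e. there exist $\beta_i\in\mathcal{KL}$ and $\gamma_{ij},\gamma_i\in\mathcal{K}_\infty\cup\{0\}$ (with $\gamma_{ii}\equiv0$) such that for all initial values $x_i(0)$ and inputs the unique solution $x_i$ satisfies for all $t\ge0$ $|x_i(t)|\le\beta_i(|x_i(0)|,t)+\sum_{j=1}^n\gamma_{ij}(\|x_{j[0,t]}\|_\infty)+\gamma_i(\|u\|_\infty)$ if $i\in I_\Sigma$, and $|x_i(t)|\le\max\{\beta_i(|x_i(0)|,t),\max_j\gamma_{ij}(\|x_{j[0,t]}\|_\infty),\gamma_i(\|u\|_\infty)\}$ if $i\in I_{\max}$. Let $\Gamma$ be the gain operator built from $(\gamma_{ij})$. If there exists $\alpha\in\mathcal{K}_\infty$ such that $\Gamma\circ D_\alpha(s)\not\ge s$ for all $s\in\mathbb{R}^n_+\setminus\{0\}$, then the whole system $\dot x=f(x,u)$ is ISS: there exist $\beta\in\mathcal{KL}$ and $\gamma\in\mathcal{K}$ with $|x(t)|\le\beta(|x(0)|,t)+\gamma(\|u\|_\infty)$ for all $x(0)$, all $u\in L_\infty$, all $t\ge0$.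
   Context: The interconnection is $\dot x_i=f_i(x_1,\dots,x_n,u_i)$, $i=1,\dots,n$, with $x_i\in\mathbb{R}^{N_i}$, $u_i\in\mathbb{R}^{m_i}$, where each $f_i$ is continuous and, for every $r$, locally Lipschitz in $x=(x_1^T,\dots,x_n^T)^T$ uniformly in $u_i$ with $|u_i|\le r$; it is written as $\dot x=f(x,u)$ with $u=(u_1^T,\dots,u_n^T)^T$. For the $i$-th subsystem the states $x_j$, $j\ne i$, are treated as independent inputs. $v_{[s_1,s_2]}$ equals $v$ on $[s_1,s_2]$ and $0$ elsewhere; $\|\cdot\|_\infty$ is the essential supremum norm. $\mathcal{K}$: continuous strictly increasing functions $\mathbb{R}_+\to\mathbb{R}_+$ vanishing at $0$; $\mathcal{K}_\infty$: unbounded ones; $\mathcal{KL}$: $\beta(\cdot,t)\in\mathcal{K}$ for each $t$ and $\beta(s,\cdot)$ nonincreasing with limit $0$. For $x,y\in\mathbb{R}^n$, $x\not\ge y$ means $x_i<y_i$ for some $i$. $\Gamma(s)=(\Gamma_1(s),\dots,\Gamma_n(s))^T$ with $\Gamma_i(s)=\sum_j\gamma_{ij}(s_j)$ for $i\in I_\Sigma$ and $\Gamma_i(s)=\max_j\gamma_{ij}(s_j)$ for $i\in I_{\max}$; $D_\alpha(s)=(D_1(s_1),\dots,D_n(s_n))^T$ with $D_i=\mathrm{id}+\alpha$ for $i\in I_\Sigma$ and $D_i=\mathrm{id}$ for $i\in I_{\max}$. *)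

(* Defs.v *)
From HB Require Import structures.
From mathcomp Require Import all_boot all_order all_algebra.
From mathcomp Require Import all_classical all_reals all_analysis.
From mathcomp Require Import ess_sup_inf.
Set Implicit Arguments. Unset Strict Implicit. Unset Printing Implicit Defensive.
Import Order.TTheory GRing.Theory Num.Theory.
Import numFieldNormedType.Exports.
Local Open Scope classical_set_scope.
Local Open Scope ring_scope.

Section Defs.
Variable R : realType.

(* ---------- comparison functions on R_+ (values outside [0,oo) irrelevant) *)
Definition classK (g : R -> R) : Prop :=
  {within [set x : R | 0 <= x], continuous g} /\
  (forall a b : R, 0 <= a -> a < b -> g a < g b) /\ g 0 = 0.

Definition classKinf (g : R -> R) : Prop :=
  classK g /\ (forall M : R, exists s : R, 0 <= s /\ M < g s).

Definition classKinf0 (g : R -> R) : Prop :=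
  classKinf g \/ (forall s : R, 0 <= s -> g s = 0).

Definition classKL (b : R -> R -> R) : Prop :=
  (forall t : R, 0 <= t -> classK (fun s => b s t)) /\
  (forall s : R, 0 <= s ->
     (forall t1 t2 : R, 0 <= t1 -> t1 <= t2 -> b s t2 <= b s t1) /\
     (b s t @[t --> +oo] --> 0)).

Definition enorm (k : nat) (v : 'I_k -> R) : R :=
  Num.sqrt (\sum_(l < k) v l ^+ 2).

Definition bvec (n : nat) (N : 'I_n -> nat) := forall i : 'I_n, 'I_(N i) -> R.

Definition bnorm (n : nat) (N : 'I_n -> nat) (x : bvec N) : R :=
  Num.sqrt (\sum_(i < n) \sum_(l < N i) x i l ^+ 2).

Definition vsub (k : nat) (v w : 'I_k -> R) : 'I_k -> R := fun l => v l - w l.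
Definition bsub (n : nat) (N : 'I_n -> nat) (x y : bvec N) : bvec N :=
  fun i l => x i l - y i l.

Definition trunc (k : nat) (s1 s2 : R) (v : R -> 'I_k -> R) : R -> 'I_k -> R :=
  fun t => if (s1 <= t) && (t <= s2) then v t else (fun _ => 0).

Definition esup (g : R -> R) : \bar R :=
  ess_sup (@lebesgue_measure R) (fun t => (g t)%:E).

Definition linf_norm (k : nat) (v : R -> 'I_k -> R) : R :=
  fine (esup (fun t => enorm (v t))).
Definition blinf_norm (n : nat) (N : 'I_n -> nat) (v : R -> bvec N) : R :=
  fine (esup (fun t => bnorm (v t))).

Definition is_Linf (k : nat) (v : R -> 'I_k -> R) : Prop :=
  (forall l : 'I_k, measurable_fun [set: R] (fun t => v t l)) /\
  (esup (fun t => enorm (v t)) < +oo)%E.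
Definition is_bLinf (n : nat) (N : 'I_n -> nat) (v : R -> bvec N) : Prop :=
  (forall (i : 'I_n) (l : 'I_(N i)), measurable_fun [set: R] (fun t => v t i l)) /\
  (esup (fun t => bnorm (v t)) < +oo)%E.

Definition I0t (t : R) : set R := `[0, t]%classic.

(* ---------- (Caratheodory) solutions on [0,T], in integral form *)
Definition is_sol (k : nat) (F : R -> ('I_k -> R) -> ('I_k -> R)) (T : R)
    (x : R -> 'I_k -> R) : Prop :=
  forall t : R, 0 <= t <= T -> forall l : 'I_k,
    (@lebesgue_measure R).-integrable (I0t t) (fun s => (F s (x s) l)%:E) /\
    ((x t l - x 0 l)%:E =
       \int[@lebesgue_measure R]_(s in I0t t) (F s (x s) l)%:E)%E.

Definition is_bsol (n : nat) (N : 'I_n -> nat) (F : R -> bvec N -> bvec N) (T : R)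
    (x : R -> bvec N) : Prop :=
  forall t : R, 0 <= t <= T -> forall (i : 'I_n) (l : 'I_(N i)),
    (@lebesgue_measure R).-integrable (I0t t) (fun s => (F s (x s) i l)%:E) /\
    ((x t i l - x 0 i l)%:E =
       \int[@lebesgue_measure R]_(s in I0t t) (F s (x s) i l)%:E)%E.

Definition rhs_continuous (n : nat) (N : 'I_n -> nat) (mi Ni : nat)
    (g : bvec N -> ('I_mi -> R) -> ('I_Ni -> R)) : Prop :=
  forall (x0 : bvec N) (u0 : 'I_mi -> R) (eps : R), 0 < eps ->
    exists d : R, 0 < d /\ forall (x : bvec N) (u : 'I_mi -> R),
      bnorm (bsub x x0) < d -> enorm (vsub u u0) < d ->
      enorm (vsub (g x u) (g x0 u0)) < eps.

Definition rhs_loc_lip (n : nat) (N : 'I_n -> nat) (mi Ni : nat)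
    (g : bvec N -> ('I_mi -> R) -> ('I_Ni -> R)) : Prop :=
  forall (r : R) (x0 : bvec N), exists d L : R, 0 < d /\
    forall (x y : bvec N) (u : 'I_mi -> R),
      bnorm (bsub x x0) < d -> bnorm (bsub y x0) < d -> enorm u <= r ->
      enorm (vsub (g x u) (g y u)) <= L * bnorm (bsub x y).

Definition Gam (n : nat) (IS : {set 'I_n}) (gam : 'I_n -> 'I_n -> R -> R)
    (s : 'I_n -> R) : 'I_n -> R :=
  fun i => if i \in IS then \sum_(j < n) gam i j (s j)
           else \big[Num.max/0]_(j < n) gam i j (s j).

Definition Dalpha (n : nat) (IS : {set 'I_n}) (alpha : R -> R)
    (s : 'I_n -> R) : 'I_n -> R :=
  fun i => if i \in IS then s i + alpha (s i) else s i.

(* ---------- mixed ISS of the i-th subsystem, x_j (j<>i) treated as inputs *)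
Definition subsystem_ISS (n : nat) (N m : 'I_n -> nat) (IS : {set 'I_n})
    (f : forall i : 'I_n, bvec N -> ('I_(m i) -> R) -> ('I_(N i) -> R))
    (i : 'I_n) (beta : R -> R -> R) (gam : 'I_n -> R -> R) (gamu : R -> R)
    : Prop :=
  forall (w : R -> bvec N) (u : R -> bvec m),
    (forall j : 'I_n, is_Linf (fun t => w t j)) -> is_bLinf u ->
  forall (T : R) (xi : R -> 'I_(N i) -> R), 0 <= T ->
    is_sol (fun s y => f i (@dfwith _ (fun j : 'I_n => 'I_(N j) -> R) (w s) i y) (u s i)) T xi ->
  forall t : R, 0 <= t <= T ->
    enorm (xi t) <=
      (if i \in IS then
         beta (enorm (xi 0)) t
         + \sum_(j < n) gam j (linf_norm (trunc 0 t (fun s => w s j)))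
         + gamu (blinf_norm u)
       else
         Num.max (beta (enorm (xi 0)) t)
           (Num.max (\big[Num.max/0]_(j < n)
                        gam j (linf_norm (trunc 0 t (fun s => w s j))))
                    (gamu (blinf_norm u)))).

End Defs.

(* Main.v *)
Require Import Defs.
From HB Require Import structures.
From mathcomp Require Import all_boot all_order all_algebra.
From mathcomp Require Import all_classical all_reals all_analysis.
From mathcomp Require Import ess_sup_inf measurable_realfun.
From mathcomp Require Import ring lra.
Set Implicit Arguments. Unset Strict Implicit. Unset Printing Implicit Defensive.
Import Order.TTheory GRing.Theory Num.Theory.
Import numFieldNormedType.Exports.
Local Open Scope classical_set_scope.
Local Open Scope ring_scope.

(** The small-gain condition says that [w <= D (Gamma w)] forces [w = 0]. If only
    [w <= Gamma w + v] (or [max] in place of [+]) is known, a pigeonhole argument finds a gap in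
    the values [w_i] above a level controlled by [v]; setting the components below the gap to 0
    costs an amount that the slack [alpha] absorbs, so all components lie below the gap and
    [w <= Phi v]. Applied to the suprema of a trajectory this gives global stability. Applied to
    the limits, as tau tends to infinity, of the suprema over [[tau, oo)] of all trajectories with
    given bounds on initial state and input, it gives uniform attractivity. Stability and
    attractivity yield the KL estimate after passing to continuous majorants. Existence of global
    solutions follows by solving, with Picard iterations, the equation clipped to a box just
    larger than the a priori bound, which the solution then never leaves. *)

(** * Comparison functions *)

(** The subsystem estimates start at time 0 and measure the other blocks by suprema over [[0, t]];
    letting tau grow in them would retain the early, large values. Each estimate therefore has to be
    restarted at an arbitrary time, which rests on the translation invariance of Lebesgue measure
    and of the notion of solution. Convergence of each single trajectory would not yield a KL
    function: the suprema are taken over a whole family, so that decay is uniform by construction.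
    The bounds [betaS] and [gamS] are found for solutions on finite intervals [[0, T]],
    independently of [T]. Such solutions are bounded because they are continuous, so global
    existence is not presupposed; afterwards the bound is what excludes blow-up. The slack [alpha]
    acts only in the rows in [IS]. The pigeonhole levels are spaced so that a component above the
    gap exceeds every gain evaluated below it, which serves the rows with [max], by a further amount
    at which [alpha] reaches the accumulated gains, which serves the rows with a sum. *)

Section WeakK.
Variable R : realType.
Implicit Types (g h : R -> R) (a b c d e r s t : R).

(* Suprema of trajectories only give monotone functions vanishing at [0+];
   continuity and strictness are restored at the very end. *)
Definition weakK g : Prop :=
  [/\ forall s, 0 <= s -> 0 <= g s,
      forall a b, 0 <= a -> a <= b -> g a <= g b &
      forall e, 0 < e -> exists2 d, 0 < d & forall s, 0 <= s -> s <= d -> g s <= e].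

Lemma weakK_ge0 g s : weakK g -> 0 <= s -> 0 <= g s.
Proof. by case=> H _ _; exact: H. Qed.

Lemma weakK_le g a b : weakK g -> 0 <= a -> a <= b -> g a <= g b.
Proof. by case=> _ H _; exact: H. Qed.

Lemma weakK_at0 g : weakK g -> g 0 = 0.
Proof.
move=> [g0 gle gs]; apply/eqP; rewrite eq_le g0 // andbT.
apply/ler_addgt0Pr => e e0; have [d d0 H] := gs _ e0.
by rewrite add0r; apply: H => //; exact: ltW.
Qed.

Lemma weakK_add g h : weakK g -> weakK h -> weakK (fun s => g s + h s).
Proof.
move=> [g0 gle gs] [h0 hle hs]; split.
- by move=> s s0; rewrite addr_ge0 ?g0 ?h0.
- by move=> a b a0 ab; rewrite lerD ?gle ?hle.
- move=> e e0; have e2 : 0 < e / 2 by rewrite divr_gt0.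
  have [d d0 Hd] := gs _ e2; have [d' d0' Hd'] := hs _ e2.
  exists (Num.min d d'); first by rewrite lt_min d0 d0'.
  move=> s s0; rewrite le_min => /andP[s1 s2].
  by rewrite [e]splitr lerD ?Hd ?Hd'.
Qed.

Lemma weakK_comp g h : weakK g -> weakK h -> weakK (fun s => g (h s)).
Proof.
move=> [g0 gle gs] [h0 hle hs]; split.
- by move=> s s0; rewrite g0 ?h0.
- by move=> a b a0 ab; rewrite gle ?hle ?h0.
- move=> e e0; have [d d0 Hd] := gs _ e0; have [d' d0' Hd'] := hs _ d0.
  by exists d' => // s s0 sd; rewrite Hd ?h0 ?Hd'.
Qed.

Lemma weakK_id : weakK (fun s => s).
Proof. by split=> // e e0; exists e. Qed.

Lemma weakK_zero : weakK (fun=> 0).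
Proof. by split=> // e e0; exists e => // s _ _; exact: ltW. Qed.

Lemma weakK_scale c : 0 <= c -> weakK (fun s => c * s).
Proof.
move=> c0; split.
- by move=> s s0; rewrite mulr_ge0.
- by move=> a b a0 ab; rewrite ler_wpM2l.
- move=> e e0; exists (e / (c + 1)); first by rewrite divr_gt0 // ltr_wpDl.
  move=> s s0 se; apply: (@le_trans _ _ ((c + 1) * s)).
    by rewrite ler_wpM2r // lerDl.
  by rewrite mulrC -ler_pdivlMr // ltr_wpDl.
Qed.

Lemma weakK_sum (I : finType) (g : I -> R -> R) :
  (forall i, weakK (g i)) -> weakK (fun s => \sum_i g i s).
Proof.
move=> gK.
suff H (r : seq I) : weakK (fun s => \sum_(i <- r) g i s) by exact: H.
elim: r => [|i r IH].
  by rewrite (_ : (fun s => _) = fun=> 0) ?funeqE => [|s]; [exact: weakK_zero|rewrite big_nil].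
rewrite (_ : (fun s => _) = fun s => g i s + \sum_(i <- r) g i s) ?funeqE.
  exact: weakK_add.
by move=> s; rewrite big_cons.
Qed.

Lemma weakK_iter g k : weakK g -> weakK (fun s => iter k g s).
Proof.
by move=> gK; elim: k => [|k IH] /=; [exact: weakK_id | exact: weakK_comp gK IH].
Qed.

Lemma classK_le g a b : classK g -> 0 <= a -> a <= b -> g a <= g b.
Proof. by move=> [_ [H _]] a0; rewrite le_eqVlt => /predU1P[->//|ab]; exact/ltW/H. Qed.

Lemma classK_ge0 g s : classK g -> 0 <= s -> 0 <= g s.
Proof. by move=> gK s0; case: (gK) => _ [_ <-]; exact: classK_le. Qed.

Lemma classK_gt0 g s : classK g -> 0 < s -> 0 < g s.
Proof. by move=> [_ [H g0]] s0; rewrite -g0 H. Qed.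

Lemma within_continuousP (A : set R) g :
  {within A, continuous g} <-> forall s e, A s -> 0 < e ->
    exists2 d, 0 < d & forall t, A t -> `|t - s| < d -> `|g t - g s| < e.
Proof.
rewrite subspace_continuousP; split=> [gc s e As e0|H s As].
  have /cvgrPdist_lt/(_ e e0)/nbhs_ballP[d /= d0 H] := gc s As.
  exists d => // t At td; rewrite distrC; apply: H => //.
  by rewrite /ball /= distrC.
apply/cvgrPdist_lt => e e0; have [d d0 Hd] := H s e As e0.
apply/nbhs_ballP; exists d => //= t ts At.
by rewrite distrC; apply: Hd => //; rewrite distrC.
Qed.

Lemma classK_weakK g : classK g -> weakK g.
Proof.
move=> gK; split.
- by move=> s; exact: classK_ge0.
- by move=> a b; exact: classK_le.
- move=> e e0; case: (gK) => gc [_ g0].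
  have [d d0 Hd] := (within_continuousP _ _).1 gc _ _ (lexx 0) e0.
  exists (d / 2); first by rewrite divr_gt0.
  move=> s s0 sd; apply: le_trans (ler_norm _) _.
  have := Hd s s0; rewrite g0 !subr0 => H; apply/ltW/H.
  by rewrite ger0_norm // (le_lt_trans sd) // ltr_pdivrMr // ltr_pMr // ltr1n.
Qed.

Lemma classKinf0_weakK g : classKinf0 g -> weakK g.
Proof.
move=> [[/classK_weakK//]|g0]; split.
- by move=> s s0; rewrite g0.
- by move=> a b a0 ab; rewrite !g0 // (le_trans a0).
- by move=> e e0; exists 1 => // s s0 _; rewrite g0 // ltW.
Qed.

(** In the limit argument the gains are evaluated at suprema over [[tau, oo)], which decrease to
    their limits as tau grows; hence the one-sided form. *)
Lemma classKinf0_right_continuous g s e : classKinf0 g -> 0 <= s -> 0 < e ->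
  exists2 d, 0 < d & forall t, s <= t -> t < s + d -> g t <= g s + e.
Proof.
move=> [[[gc _] _]|g0] s0 e0.
  have [d d0 Hd] := (within_continuousP _ _).1 gc _ _ s0 e0.
  exists d => // t st td; have t0 := le_trans s0 st.
  rewrite -lerBlDl; apply: le_trans (ler_norm _) _; apply/ltW/Hd => //.
  by rewrite ger0_norm ?subr_ge0 // ltrBlDl.
by exists 1 => // t st _; rewrite !g0 ?add0r ?(ltW e0) // (le_trans s0).
Qed.

Lemma classKinf_surj g c : classKinf g -> 0 <= c -> exists2 s, 0 <= s & g s = c.
Proof.
move=> [gK gu] c0; have [s1 [s10 cs1]] := gu c; case: (gK) => gc [_ g00].
have gc1 : {within `[0, s1], continuous g}.
  apply: continuous_subspaceW gc => x /=; rewrite in_itv /= => /andP[] //.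
have [|s] := IVT s10 gc1 (v := c).
  rewrite g00 (min_idPl _) ?(max_idPr _) ?(classK_ge0 gK) // c0 /=; exact: ltW.
by rewrite in_itv /= => /andP[s0 _] gs; exists s.
Qed.

(** For [g] of class Kinf this is the inverse on the half-line, as a chosen preimage; at negative
    [c] it is a default value. *)
Definition kinv g c : R := get [set s | 0 <= s /\ g s = c].

Lemma kinvP g c : classKinf g -> 0 <= c -> 0 <= kinv g c /\ g (kinv g c) = c.
Proof.
move=> gK c0; have [s s0 gs] := classKinf_surj gK c0.
exact: (@getI _ [set s | 0 <= s /\ g s = c] s).
Qed.

Lemma weakK_kinv g : classKinf g -> weakK (kinv g).
Proof.
move=> gK; have [gK' _] := gK; have [_ [gi _]] := gK'.
have le a s : 0 <= a -> 0 <= s -> a <= g s -> kinv g a <= s.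
  move=> a0 s0 H; have [k0 kE] := kinvP gK a0.
  by rewrite leNgt; apply/negP => sk; have := gi _ _ s0 sk; rewrite ltNge kE H.
split.
- by move=> s s0; have [] := kinvP gK s0.
- move=> a b a0 ab; have b0 := le_trans a0 ab; have [k0 kb] := kinvP gK b0.
  by apply: le => //; rewrite kb.
- move=> e e0; exists (g e); first exact: classK_gt0.
  by move=> s s0 se; apply: le => //; exact: ltW.
Qed.

End WeakK.

(** * The small-gain inequality *)

Section SmallGain.
Variables (R : realType) (n : nat) (IS : {set 'I_n}).
Variables (gam : 'I_n -> 'I_n -> R -> R) (alpha : R -> R).
Implicit Types (s w : 'I_n -> R) (r v : R).
Hypothesis gamK : forall i j, weakK (gam i j).
Hypothesis alphaK : classKinf alpha.
Hypothesis small_gain : forall s : 'I_n -> R, (forall i, 0 <= s i) ->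
  (exists i, s i != 0) -> exists i, Gam IS gam (Dalpha IS alpha s) i < s i.

Lemma Gam_ge0 s i : (forall j, 0 <= s j) -> 0 <= Gam IS gam s i.
Proof.
move=> s0; rewrite /Gam; case: ifP => _; last exact: bigmax_ge_id.
by apply: sumr_ge0 => j _; exact: weakK_ge0.
Qed.

Lemma le_Gam s s' i : (forall j, 0 <= s j) -> (forall j, s j <= s' j) ->
  Gam IS gam s i <= Gam IS gam s' i.
Proof.
move=> s0 ss'; rewrite /Gam; case: ifP => _.
  by apply: ler_sum => j _; exact: weakK_le.
by apply: le_bigmax2 => j _; exact: weakK_le.
Qed.

(** The hypothesis concerns [Gamma o D], while the applications produce inequalities for
    [D o Gamma]. Since [D] is invertible on nonnegative vectors, [t = D^-1 s] turns
    [s <= D (Gamma s)] into [t <= Gamma (D t)], which the hypothesis excludes unless [t = 0]. *)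
Lemma small_gain_swap s : (forall i, 0 <= s i) ->
  (forall i, s i <= Dalpha IS alpha (Gam IS gam s) i) -> forall i, s i = 0.
Proof.
move=> s0 sD; have [aK _] := alphaK; have [ac [ai a0]] := aK.
have DK : classKinf (fun r => r + alpha r).
  split; first split.
  - apply/within_continuousP => r e r0 e0.
    have [d d0 Hd] := (within_continuousP _ _).1 ac _ _ r0 (divr_gt0 e0 (@ltr0Sn R 1)).
    exists (Num.min d (e / 2)); first by rewrite lt_min d0 divr_gt0.
    move=> t t0; rewrite lt_min => /andP[td te].
    rewrite opprD addrACA; apply: le_lt_trans (ler_normD _ _) _.
    by rewrite [e]splitr ltrD // Hd.
  - split; last by rewrite a0 addr0.
    by move=> a b a1 ab; rewrite ltrD // ai.
  - move=> M; have [_ au] := alphaK; have [r [r0 Mr]] := au M.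
    by exists r; split => //; rewrite ltr_wpDl.
have [DK' _] := DK; have [_ [Di _]] := DK'.
pose t i := if i \in IS then kinv (fun r => r + alpha r) (s i) else s i.
have t0 i : 0 <= t i.
  by rewrite /t; case: ifP => // _; have [] := kinvP DK (s0 i).
have Dt : Dalpha IS alpha t = s.
  apply/funext => i; rewrite /Dalpha /t; case: (i \in IS) => //.
  by have [_] := kinvP DK (s0 i).
have tG i : t i <= Gam IS gam s i.
  have := sD i; rewrite /Dalpha /t; case: ifP => // iIS H.
  have [k0 kE] := kinvP DK (s0 i); rewrite leNgt; apply/negP => lt.
  by have := Di _ _ (Gam_ge0 i s0) lt; rewrite kE ltNge H.
have t00 i : t i = 0.
  apply/eqP/negPn/negP => ti; have [|j] := small_gain t0; first by exists i.
  by rewrite Dt ltNge tG.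
by move=> i; rewrite -Dt /Dalpha t00 a0 addr0 if_same.
Qed.

Definition gain_sum (r : R) : R := r + \sum_(p : 'I_n * 'I_n) gam p.1 p.2 r.
(** [gain_sum r] dominates [r], each gain and each row sum of gains at [r]. The second summand is
    the size from which on [alpha] is at least that large. *)
Definition gain_step (r : R) : R := gain_sum r + kinv alpha (gain_sum r).
(** The gap starts at one of the levels 0 to [n], so whatever lies below it is at most the [n]-th
    level. *)
Definition gain_bound (r : R) : R := iter n gain_step r.

Lemma weakK_gain_sum : weakK gain_sum.
Proof. by apply: weakK_add; [exact: weakK_id | exact: weakK_sum]. Qed.

Lemma weakK_gain_step : weakK gain_step.
Proof.
apply: weakK_add; first exact: weakK_gain_sum.
by apply: weakK_comp; [exact: weakK_kinv | exact: weakK_gain_sum].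
Qed.

Lemma weakK_gain_bound : weakK gain_bound.
Proof. exact: weakK_iter weakK_gain_step. Qed.

Lemma gain_step_ge r : 0 <= r -> r <= gain_step r.
Proof.
move=> r0; rewrite /gain_step /gain_sum -addrA lerDl addr_ge0 //.
  by apply: sumr_ge0 => p _; exact: weakK_ge0.
by have [|] // := @kinvP _ alpha (gain_sum r) alphaK; exact: weakK_ge0 weakK_gain_sum _.
Qed.

Lemma iter_gain_step_le k l v : 0 <= v -> (k <= l)%N ->
  iter k gain_step v <= iter l gain_step v.
Proof.
move=> v0 /subnK <-; elim: (l - k)%N => // d IH.
rewrite addSn /= (le_trans IH) // gain_step_ge //.
exact: (weakK_ge0 (weakK_iter _ weakK_gain_step)).
Qed.

(* Pigeonhole: n values cannot meet all n+1 consecutive intervals. *)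
Lemma gain_gap (w : 'I_n -> R) v : 0 <= v ->
  exists2 k, (k <= n)%N & forall i, w i <= iter k gain_step v \/
                                    gain_step (iter k gain_step v) < w i.
Proof.
move=> v0; apply: contrapT => H.
have /choice[h hP] : forall k : 'I_n.+1, exists i : 'I_n,
    iter k gain_step v < w i /\ w i <= iter k.+1 gain_step v.
  move=> k; apply: contrapT => Hk; apply: H; exists k; first by rewrite -ltnS.
  move=> i; have [|lt1] := leP (w i) (iter k gain_step v); first by left.
  right; rewrite ltNge; apply/negP => le2; apply: Hk; by exists i.
have hi : injective h.
  move=> k l hkl; apply/val_inj/eqP; rewrite eqn_leq.
  have [k1 k2] := hP k; have [l1 l2] := hP l; rewrite hkl in k1 k2.
  apply/andP; split; rewrite leqNgt; apply/negP => lt.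
    by have := le_lt_trans (iter_gain_step_le v0 lt) k1; rewrite ltNge l2.
  by have := le_lt_trans (iter_gain_step_le v0 lt) l1; rewrite ltNge k2.
by have := leq_card h hi; rewrite !card_ord ltnn.
Qed.

(* Components below a gap are replaced by 0; what they contributed is absorbed
   by the slack [alpha] because the remaining components lie above the gap. *)
Lemma small_gain_bound (w : 'I_n -> R) v : 0 <= v -> (forall i, 0 <= w i) ->
  (forall i, w i <= if i \in IS then Gam IS gam w i + v
                    else Num.max (Gam IS gam w i) v) ->
  forall i, w i <= gain_bound v.
Proof.
move=> v0 w0 wG; have [k kn gap] := gain_gap w v0.
set r := iter k gain_step v in gap.
have r0 : 0 <= r by exact: (weakK_ge0 (weakK_iter _ weakK_gain_step)).
have vr : v <= r by exact: (@iter_gain_step_le 0).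
pose w' i := if w i <= r then 0 else w i.
have w'0 i : 0 <= w' i by rewrite /w'; case: ifP.
have w'w i : w' i <= w i by rewrite /w'; case: ifP.
have wr i : w i <= r -> w i <= gain_bound v.
  by move=> wi; rewrite (le_trans wi) // iter_gain_step_le.
suff w'00 : forall i, w' i = 0.
  move=> i; have := w'00 i; rewrite /w'; case: ifP => [wi _|_ ->]; first exact: wr.
  exact: (weakK_ge0 weakK_gain_bound).
apply: small_gain_swap => // i; have G'0 := Gam_ge0 i w'0.
have aK : classK alpha by case: alphaK.
have D0 : 0 <= Dalpha IS alpha (Gam IS gam w') i.
  by rewrite /Dalpha; case: ifP => // _; rewrite addr_ge0 // (classK_ge0 aK).
rewrite {1}/w'; case: ifPn => // wri; have [|gi] := gap i; first by rewrite (negbTE wri).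
have c0 := weakK_ge0 weakK_gain_sum r0.
have [k0 kE] := kinvP alphaK c0.
have gamw j : gam i j (w j) <= Num.max (gam i j (w' j)) (gam i j r).
  rewrite /w'; case: ifP => wj; rewrite le_max; last by rewrite lexx.
  by rewrite (weakK_le (gamK i j) (w0 j) wj) orbT.
have sumr_row : \sum_j gam i j r <= \sum_(p : 'I_n * 'I_n) gam p.1 p.2 r.
  rewrite -(pair_bigA _ (fun i j => gam i j r)) /= [leRHS](bigD1 i) //= lerDl sumr_ge0 // => j _; apply: sumr_ge0 => l _.
  exact: weakK_ge0.
have csum j : gam i j r <= gain_sum r.
  rewrite /gain_sum ler_wpDl // (le_trans _ sumr_row) //.
  rewrite (bigD1 j) //= lerDl sumr_ge0 // => l _; exact: weakK_ge0.
have := wG i; rewrite /Dalpha; case: ifPn => iIS wi.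
  have wi2 : w i <= Gam IS gam w' i + gain_sum r.
    rewrite (le_trans wi) // /gain_sum [r + _]addrC addrA lerD //.
    apply: le_trans (_ : _ <= Gam IS gam w' i + \sum_j gam i j r) _; last by rewrite lerD2l.
    rewrite /Gam iIS -big_split /=; apply: ler_sum => j _.
    by rewrite (le_trans (gamw j)) // ge_max lerDl lerDr; apply/andP; split; exact: weakK_ge0.
  (* Either [Gamma w'] is so small that [w i <= gain_step r], against the gap, or [alpha (Gamma w')]
     reaches [gain_sum r], which covers both the truncation and [v]. *)
  have [lt|] := ltP (Gam IS gam w' i) (kinv alpha (gain_sum r)).
    exfalso; move: gi; rewrite ltNge /gain_step (le_trans wi2) // addrC lerD2l.
    exact: ltW.
  move=> ge; rewrite (le_trans wi2) // lerD2l -[X in X <= _]kE.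
  exact: classK_le aK _ _.
(* A row with [max] has no slack, but here [w i] exceeds [v] and every gain at [r], so the maximum
   can only come from the components that were kept. *)
have gc : gain_sum r < w i by rewrite (le_lt_trans _ gi) // /gain_step lerDl.
move: wi; rewrite le_max => /orP[|wv]; last first.
  exfalso; move: gc; rewrite ltNge (le_trans wv) // (le_trans vr) //.
  rewrite /gain_sum lerDl sumr_ge0 // => p _; exact: weakK_ge0.
move=> wi; rewrite leNgt; apply/negP => lt; move: wi; rewrite leNgt => /negP; apply.
rewrite {1}/Gam (negbTE iIS); apply/bigmax_ltP; split; first exact: le_lt_trans c0 gc.
move=> j _; rewrite (le_lt_trans (gamw j)) // gt_max (le_lt_trans (csum j) gc) andbT.
apply: le_lt_trans lt; rewrite /Gam (negbTE iIS).
exact: (le_bigmax _ (fun j => gam i j (w' j))).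
Qed.

End SmallGain.

(** * Uniform attractivity of abstract trajectories *)

Section Trajectories.
Variables (R : realType) (n : nat) (IS : {set 'I_n}).
Variables (gam : 'I_n -> 'I_n -> R -> R) (alpha : R -> R).
Variables (beta : 'I_n -> R -> R -> R) (gamu : 'I_n -> R -> R).
Hypothesis gamK : forall i j, classKinf0 (gam i j).
Hypothesis gamuK : forall i, weakK (gamu i).
Hypothesis betaK : forall i, classKL (beta i).
Hypothesis alphaK : classKinf alpha.
Hypothesis small_gain : forall s : 'I_n -> R, (forall i, 0 <= s i) ->
  (exists i, s i != 0) -> exists i, Gam IS gam (Dalpha IS alpha s) i < s i.

(* [len], [size0] and [inp] stand for the length of the time interval, a bound
   on the initial state and the norm of the input. *)
Variables (Tr : Type) (len size0 inp : Tr -> R) (y : Tr -> 'I_n -> R -> R).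
Implicit Types (s t e r mu tau a b d : R) (p : Tr) (i j : 'I_n).
Hypothesis size0_ge0 : forall p, 0 <= size0 p.
Hypothesis inp_ge0 : forall p, 0 <= inp p.
Hypothesis y_ge0 : forall p i t, 0 <= y p i t.
Hypothesis y_init : forall p i, y p i 0 <= size0 p.
Hypothesis y_bounded : forall p i, exists B, forall t, 0 <= t <= len p -> y p i t <= B.
(** The subsystem estimate restarted at time [s], with arbitrary pointwise bounds [b] on [[s, t]] in
    place of essential suprema. *)
Hypothesis y_est : forall p i s t (b : 'I_n -> R),
  0 <= s -> s <= t -> t <= len p -> (forall j, 0 <= b j) ->
  (forall j r, s <= r <= t -> y p j r <= b j) ->
  y p i t <= if i \in IS then
               beta i (y p i s) (t - s) + Gam IS gam b i + gamu i (inp p)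
             else Num.max (beta i (y p i s) (t - s))
                          (Num.max (Gam IS gam b i) (gamu i (inp p))).

Let gamwK i j : weakK (gam i j). Proof. exact: classKinf0_weakK. Qed.
Let Phi := gain_bound gam alpha.
Let PhiK : weakK Phi. Proof. exact: weakK_gain_bound. Qed.

Let betaWK i : weakK (fun s => beta i s 0).
Proof. by apply: classK_weakK; have [+ _] := betaK i; exact. Qed.

Let beta_le i a b t : 0 <= a -> a <= b -> 0 <= t -> beta i a t <= beta i b t.
Proof. by move=> a0 ab t0; have [/(_ t t0)bK _] := betaK i; exact: (classK_le bK). Qed.

Let beta_anti i a s t : 0 <= a -> 0 <= s -> s <= t -> beta i a t <= beta i a s.
Proof. by move=> a0 s0 st; have [_ /(_ a a0)[+ _]] := betaK i; exact. Qed.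

Let beta_small i a e : 0 <= a -> 0 < e -> exists2 t, 0 <= t & beta i a t <= e.
Proof.
move=> a0 e0; have [_ /(_ a a0)[_ /cvgrPdist_le/(_ e e0)]] := betaK i.
move=> [M [_ H]]; pose t := Num.max 0 (M + 1).
have t0 : 0 <= t by rewrite le_max lexx.
exists t => //; have := H t; rewrite sub0r normrN => Ht.
apply: le_trans (ler_norm _) _; apply: Ht.
by rewrite lt_max ltrDl ltr01 orbT.
Qed.

Definition init_bound r := \sum_i beta i r 0.
Definition inp_bound r := \sum_i gamu i r.

Lemma weakK_init_bound : weakK init_bound.
Proof. exact: weakK_sum. Qed.

Lemma weakK_inp_bound : weakK inp_bound.
Proof. exact: weakK_sum. Qed.

Lemma gamu_le_inp_bound i r : 0 <= r -> gamu i r <= inp_bound r.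
Proof.
move=> r0; rewrite /inp_bound (bigD1 i) //= lerDl sumr_ge0 // => j _.
exact: weakK_ge0.
Qed.

Lemma beta_le_init_bound i r : 0 <= r -> beta i r 0 <= init_bound r.
Proof.
move=> r0; rewrite /init_bound (bigD1 i) //= lerDl sumr_ge0 // => j _.
exact: weakK_ge0 (betaWK j) _.
Qed.

(** The suprema of the components over the whole interval satisfy the gain inequality with
    [v = v1 + v2]: each estimate from time 0 has a right-hand side that no longer depends on the
    time. *)
Lemma global_stability p i t : 0 <= t <= len p ->
  y p i t <= Phi (2 * init_bound (size0 p)) + Phi (2 * inp_bound (inp p)).
Proof.
move=> /andP[t0 tT].
set v1 := init_bound (size0 p); set v2 := inp_bound (inp p).
have v10 : 0 <= v1 by exact: weakK_ge0 weakK_init_bound _.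
have v20 : 0 <= v2 by exact: weakK_ge0 weakK_inp_bound _.
pose E j := [set y p j s | s in [set s | 0 <= s <= len p]].
have Esup j : has_sup (E j).
  split; first by exists (y p j 0), 0 => //=; rewrite lexx (le_trans t0).
  by have [B HB] := y_bounded p j; exists B => _ [s /= sT <-]; exact: HB.
have yE j s : 0 <= s <= len p -> y p j s <= sup (E j).
  by move=> sT; apply: ub_le_sup; [case: (Esup j) | exists s].
have w0 j : 0 <= sup (E j).
  by apply: le_trans (yE j 0 _) => //; rewrite lexx (le_trans t0).
suff H j : sup (E j) <= if j \in IS then Gam IS gam (fun j => sup (E j)) j + (v1 + v2)
                    else Num.max (Gam IS gam (fun j => sup (E j)) j) (v1 + v2).
  apply: le_trans (yE i t _) _; first by rewrite t0.
  apply: le_trans (small_gain_bound gamwK alphaK small_gain (addr_ge0 v10 v20) w0 H i) _.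
  (* Monotonicity replaces subadditivity: [v1 + v2] is at most twice the larger term, so
     [Phi (v1 + v2) <= Phi (2 v1) + Phi (2 v2)]. *)
  wlog le12 : v1 v2 v10 v20 {H} / v1 <= v2.
    move=> W; have [|/ltW] := leP v1 v2; first exact: W.
    by move=> le21; rewrite [v1 + v2]addrC [leRHS]addrC; exact: W.
  rewrite ler_wpDl //; first by apply: weakK_ge0 => //; rewrite mulr_ge0.
  apply: weakK_le => //; first by rewrite addr_ge0.
  by rewrite mulr_natl mulr2n lerD2r.
apply: sup_le_ub; first by case: (Esup j).
move=> _ [s /= /andP[s0 sT] <-].
have := @y_est p j 0 s (fun j => sup (E j)) (lexx 0) s0 sT w0.
have b0 : beta j (y p j 0) (s - 0) <= v1.
  rewrite subr0 (le_trans (beta_anti _ _ _ s0)) // (le_trans _ (beta_le_init_bound j _)) //.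
  exact: beta_le.
have g0 : gamu j (inp p) <= v2 by exact: gamu_le_inp_bound.
move=> /(_ _) /le_trans; apply.
  by move=> l r /andP[r0 rs]; rewrite yE // r0 (le_trans rs).
case: ifP => _; first by rewrite addrAC addrC lerD2l lerD.
rewrite !ge_max !le_max lexx; apply/and3P; split=> //; apply/orP; right.
  by apply: le_trans b0 _; rewrite lerDl.
by apply: le_trans g0 _; rewrite lerDr.
Qed.

Lemma Gam_right_continuous (l : 'I_n -> R) e : (forall j, 0 <= l j) -> 0 < e ->
  exists2 d, 0 < d & forall w : 'I_n -> R, (forall j, l j <= w j < l j + d) ->
    forall i, Gam IS gam w i <= Gam IS gam l i + e.
Proof.
(* A row with a sum collects the error [n] times; dividing by [n + 1] also covers [n = 0] and a row
   with [max]. *)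
move=> l0 e0; pose e' := e / n.+1%:R.
have e'0 : 0 < e' by rewrite divr_gt0.
have /choice[d dP] : forall q : 'I_n * 'I_n, exists d, 0 < d /\
    forall t, l q.2 <= t -> t < l q.2 + d -> gam q.1 q.2 t <= gam q.1 q.2 (l q.2) + e'.
  move=> [i j] /=; have [d d0 Hd] := classKinf0_right_continuous (gamK i j) (l0 j) e'0.
  by exists d.
exists (\big[Num.min/1]_q d q).
  by apply/bigmin_gtP; split => // q _; case: (dP q).
move=> w Hw i.
have H j : gam i j (w j) <= gam i j (l j) + e'.
  have [_ /(_ (w j))] := dP (i, j); have /andP[w1 w2] := Hw j.
  by apply => //; apply: lt_le_trans w2 _; rewrite lerD2l; apply: bigmin_le_cond.
have e'e : n%:R * e' <= e.
  rewrite /e' mulrCA ger_pMr // ler_pdivrMr ?ltr0Sn // mul1r ler_nat //.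
have e'e1 : e' <= e.
  by rewrite /e' ler_pdivrMr ?ltr0Sn // ler_peMr ?(ltW e0) // ler1n.
rewrite /Gam; case: ifP => _.
  apply: le_trans (ler_sum _ (fun j _ => H j)) _.
  by rewrite big_split /= sumr_const card_ord -mulr_natl lerD2l.
apply: bigmax_le => [|j _].
  by rewrite addr_ge0 ?(ltW e0) // bigmax_ge_id.
apply: le_trans (H j) _; apply: lerD => //.
exact: (le_bigmax _ (fun j => gam i j (l j))).
Qed.

(* The limits [l] of the suprema over all trajectories of a given size satisfy the
   gain inequality exactly, so the small-gain bound applies to them. *)
Lemma attractivity_at_level r mu e : 0 <= r -> 0 <= mu -> 0 < e ->
  exists2 tau, 0 <= tau & forall p i t, size0 p <= r -> inp p <= mu ->
    tau <= t -> t <= len p -> y p i t <= Phi (inp_bound mu) + e.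
Proof.
move=> r0 mu0 e0.
pose C := Phi (2 * init_bound r) + Phi (2 * inp_bound mu).
have m2 := @weakK_scale R 2 (ler0n _ 2).
have C0 : 0 <= C.
  by rewrite addr_ge0 //; apply: weakK_ge0 => //; apply: (weakK_ge0 m2);
     [exact: weakK_ge0 weakK_init_bound _|exact: weakK_ge0 weakK_inp_bound _].
have yC p i t : size0 p <= r -> inp p <= mu -> 0 <= t <= len p -> y p i t <= C.
  move=> pr pmu tT; apply: le_trans (global_stability i tT) _.
  apply: lerD; apply: weakK_le => //.
  - apply: (weakK_ge0 m2); exact: weakK_ge0 weakK_init_bound _.
  - by rewrite ler_pM2l //; apply: weakK_le => //; exact: weakK_init_bound.
  - apply: (weakK_ge0 m2); exact: weakK_ge0 weakK_inp_bound _.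
  - by rewrite ler_pM2l //; apply: weakK_le => //; exact: weakK_inp_bound.
(* The element 0 keeps the set nonempty when no trajectory lasts until [tau], and makes its supremum
   nonnegative. *)
pose E i tau := [set z | z = 0 \/ exists p t,
  [/\ size0 p <= r, inp p <= mu, tau <= t, t <= len p & z = y p i t]].
pose S i tau := sup (E i tau).
have E0 i tau : E i tau !=set0 by exists 0; left.
have Eub i tau : 0 <= tau -> ubound (E i tau) C.
  move=> tau0 z [->//|[p [t [pr pmu tt tT ->]]]].
  by apply: yC => //; rewrite tT (le_trans tau0).
have Ehs i tau : 0 <= tau -> has_sup (E i tau).
  by move=> tau0; split=> //; exists C; exact: Eub.
have yS p i t tau : 0 <= tau -> size0 p <= r -> inp p <= mu -> tau <= t ->
    t <= len p -> y p i t <= S i tau.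
  move=> tau0 pr pmu tt tT; apply: ub_le_sup; first by case: (Ehs i tau tau0).
  by right; exists p, t.
have S0 i tau : 0 <= tau -> 0 <= S i tau.
  by move=> tau0; apply: ub_le_sup; [case: (Ehs i tau tau0)|left].
have Sle i s t : 0 <= s -> s <= t -> S i t <= S i s.
  move=> s0 st; apply: sup_le_ub => // z [->|[p [t' [pr pmu tt tT ->]]]]; first exact: S0.
  by apply: yS => //; exact: le_trans tt.
pose L i := [set S i tau | tau in [set tau | 0 <= tau]].
pose l i := inf (L i).
have L0 i : L i !=set0 by exists (S i 0); exists 0 => /=.
have Lhi i : has_inf (L i).
  by split=> //; exists 0 => _ [tau /= tau0 <-]; exact: S0.
have l0 i : 0 <= l i by apply: lb_le_inf => // _ [tau /= tau0 <-]; exact: S0.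
have lS i tau : 0 <= tau -> l i <= S i tau.
  by move=> tau0; apply: ge_inf; [case: (Lhi i)|exists tau].
have Sl d : 0 < d -> exists2 tau, 0 <= tau & forall i, S i tau < l i + d.
  move=> d0; have /choice[tau tauP] : forall i, exists tau, 0 <= tau /\ S i tau < l i + d.
    move=> i; have [_ [tau /= tau0 <-] lt] := inf_adherent d0 (Lhi i).
    by exists tau.
  pose M := \big[Num.max/0]_i tau i.
  exists M; first exact: bigmax_ge_id.
  move=> i; have [t0 /(le_lt_trans _)] := tauP i; apply; apply: Sle => //.
  exact: le_bigmax.
suff lG i : l i <= if i \in IS then Gam IS gam l i + inp_bound mu
                   else Num.max (Gam IS gam l i) (inp_bound mu).
  have lP := small_gain_bound gamwK alphaK small_gain
    (weakK_ge0 weakK_inp_bound mu0) l0 lG.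
  have [tau tau0 Htau] := Sl _ e0; exists tau => // p i t pr pmu tt tT.
  apply: le_trans (yS _ _ _ _ tau0 pr pmu tt tT) _.
  by apply: le_trans (ltW (Htau i)) _; rewrite lerD2r.
(* Restart at a [tau] after which the suprema are so close to [l] that [Gamma] changes by at most
   [e1 / 2], then wait for [tau'], in which [beta i] brings the global bound [C] below [e1 / 2]. *)
apply/ler_addgt0Pr => e1 e10; have e20 : 0 < e1 / 2 by rewrite divr_gt0.
have [d d0 Hd] := Gam_right_continuous l0 e20.
have [tau tau0 Htau] := Sl _ d0.
have [tau' tau'0 Htau'] := beta_small i C0 e20.
have GS j : Gam IS gam (fun j => S j tau) j <= Gam IS gam l j + e1 / 2.
  by apply: Hd => k; rewrite lS // Htau.
have e12 : e1 / 2 <= e1 by rewrite ler_pdivrMr // ler_peMr ?ltW // ltr1n.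
have G0 : 0 <= Gam IS gam l i by exact: Gam_ge0.
have i0 : 0 <= inp_bound mu by exact: weakK_ge0 weakK_inp_bound _.
apply: (le_trans (lS i _ (addr_ge0 tau0 tau'0))).
apply: sup_le_ub => // z [->|[p [t [pr pmu tt tT ->]]]].
  by apply: addr_ge0; [case: ifP => _; rewrite ?addr_ge0 // le_max G0|exact: ltW].
have taut : tau <= t by apply: le_trans tt; rewrite lerDl.
have := @y_est p i tau t (fun j => S j tau) tau0 taut tT (fun j => S0 j _ tau0).
move=> /(_ _) /le_trans; apply.
  by move=> j s /andP[s1 s2]; apply: yS => //; exact: le_trans tT.
have b1 : beta i (y p i tau) (t - tau) <= e1 / 2.
  apply: le_trans Htau'; apply: (@le_trans _ _ (beta i C (t - tau))).
    by apply: beta_le; rewrite ?subr_ge0 // yC // tau0 (le_trans taut).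
  by apply: beta_anti => //; rewrite lerBrDl.
have g1 : gamu i (inp p) <= inp_bound mu.
  by apply: le_trans (gamu_le_inp_bound i mu0); exact: weakK_le.
have Gi := GS i.
case: ifP => _.
  rewrite [e1]splitr; move: b1 g1 Gi; set A := beta _ _ _; set B := Gam _ _ _ _.
  set c := gamu _ _; set D := Gam _ _ _ _; lra.
rewrite !ge_max; apply/and3P; split.
- by apply: le_trans b1 _; apply: le_trans e12 _; rewrite lerDr le_max G0.
- apply: le_trans Gi _; apply: lerD => //; by rewrite le_max lexx.
- apply: le_trans g1 _; apply: (@le_trans _ _ (Num.max (Gam IS gam l i) (inp_bound mu))).
    by rewrite le_max lexx orbT.
  by rewrite lerDl ltW.
Qed.

(* Uniformity in the input norm: on the cell [k d, (k+1) d], [k >= 1], the right end is at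
   most twice the left one. *)
Lemma uniform_attractivity r e : 0 < e ->
  exists tau, forall p i t, size0 p <= r -> inp p <= r ->
    0 <= t -> tau <= t -> t <= len p -> y p i t <= Phi (inp_bound (2 * inp p)) + e.
Proof.
move=> e0; have [r0|r0] := ltP r 0.
  exists 0 => p i t pr; have := le_lt_trans pr r0; by rewrite ltNge size0_ge0.
have e20 : 0 < e / 2 by rewrite divr_gt0.
have QK : weakK (fun mu => Phi (inp_bound mu)).
  by apply: weakK_comp => //; exact: weakK_inp_bound.
(* The cell starting at 0 has no positive left end to double; [d] is chosen so small that there the
   input term is itself absorbed by half of [e]. *)
have [d d0 Hd] : exists2 d, 0 < d & Phi (inp_bound d) <= e / 2.
  by have [_ _ /(_ _ e20)[d d0 Hd]] := QK; exists d => //; apply: Hd => //; exact: ltW.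
have H (k : nat) : exists tau, forall p i t, size0 p <= r -> inp p <= k.+1%:R * d ->
    0 <= t -> tau <= t -> t <= len p -> y p i t <= Phi (inp_bound (2 * inp p)) + e.
  elim: k => [|k [tau IH]].
    have [tau tau0 Ht] := attractivity_at_level r0 (ltW d0) e20.
    exists tau => p i t pr; rewrite mul1r => pd t0 taut tT.
    apply: le_trans (Ht p i t pr pd taut tT) _.
    rewrite [e in leRHS]splitr addrA lerD2r; apply: le_trans Hd _; rewrite lerDr.
    by apply: (weakK_ge0 QK); rewrite mulr_ge0.
  have kd0 : 0 <= k.+2%:R * d by rewrite mulr_ge0 // ltW.
  have [tau' tau'0 Ht] := attractivity_at_level r0 kd0 e0.
  exists (Num.max tau tau') => p i t pr pd t0; rewrite ge_max => /andP[tt tt'] tT.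
  have [pk|/ltW pk] := leP (inp p) (k.+1%:R * d); first exact: IH.
  apply: le_trans (Ht p i t pr pd tt' tT) _; rewrite lerD2r.
  apply: (weakK_le QK kd0); apply: le_trans (_ : _ <= 2 * (k.+1%:R * d)) _.
    by rewrite mulrA ler_pM2r // -natrM ler_nat mul2n -addnn addSn addnS !ltnS leq_addl.
  by rewrite ler_pM2l.
have [tau Ht] := H (Num.bound (r / d)); exists tau => p i t pr pr'.
apply: Ht => //; apply: le_trans pr' _; rewrite -ler_pdivrMr //.
have rd0 : 0 <= r / d by rewrite divr_ge0 // ltW.
by apply/ltW/(lt_le_trans (archi_boundP rd0)); rewrite ler_nat.
Qed.

End Trajectories.

(** * Continuous majorants *)

Section Majorant.
Variable R : realType.
Implicit Types (g : R -> R) (a b c d e r s t m M : R).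

(** For [s > 0] a trapezoidal weight in [r >= 0]: it is 1 up to [s] and falls linearly to 0 at
    [2 s]. *)
Definition cutoff r s : R := Num.max 0 (Num.min 1 (2 - r / s)).

(** A regularisation: [g] may jump, but the weights vary continuously with [s > 0], and the supremum
    stays between [g s] and [g (2 s)]. *)
Definition maj_set g s := [set g r * cutoff r s | r in [set r | 0 <= r]].

(** At [s = 0] the convention [r / 0 = 0] would give every [r] the weight 1, hence the separate
    value. *)
Definition majorant g s : R := if s <= 0 then 0 else sup (maj_set g s).

Lemma cutoff_ge0 r s : 0 <= cutoff r s.
Proof. by rewrite le_max lexx. Qed.

Lemma cutoff_le1 r s : cutoff r s <= 1.
Proof. by rewrite ge_max ler01 ge_min lexx. Qed.

Lemma cutoff_id s : 0 < s -> cutoff s s = 1.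
Proof.
move=> s0; rewrite /cutoff divff ?gt_eqF //.
by rewrite (_ : 2 - 1 = 1 :> R) ?minxx ?(max_idPr _) //; lra.
Qed.

Lemma cutoff_eq0 r s : 0 < s -> 2 * s <= r -> cutoff r s = 0.
Proof.
move=> s0 sr; apply/eqP; rewrite /cutoff eq_le le_max lexx andbT ge_max lexx /=.
by rewrite ge_min; apply/orP; right; rewrite subr_le0 ler_pdivlMr.
Qed.

Lemma cutoff_le r s t : 0 <= r -> 0 < s -> s <= t -> cutoff r s <= cutoff r t.
Proof.
move=> r0 s0 st; have t0 := lt_le_trans s0 st.
rewrite /cutoff ge_max !le_max lexx /=; apply/orP; right; rewrite le_min !ge_min lexx /=; apply/orP; right.
by rewrite lerD2l lerN2 ler_wpM2l // lef_pV2.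
Qed.

Lemma cutoff_lip r s t : cutoff r s <= cutoff r t + `|r / s - r / t|.
Proof.
rewrite /cutoff; set x := r / s; set z := r / t.
have := ler_norm (x - z); have := ler_norm (z - x); rewrite distrC.
have := normr_ge0 (x - z); set q := `|x - z|.
rewrite !minEle !maxEle; do !case: ifPn; rewrite -?ltNge; lra.
Qed.

Lemma maj_set_ub g s : weakK g -> 0 < s -> ubound (maj_set g s) (g (2 * s)).
Proof.
move=> gK s0 _ [r /= r0 <-].
have [rs|/ltW rs] := leP r (2 * s); last first.
  by rewrite cutoff_eq0 // mulr0; apply: weakK_ge0 => //; rewrite mulr_ge0 // ltW.
apply: le_trans (_ : _ <= g r) _; last exact: weakK_le.
by rewrite ler_piMr ?cutoff_le1 // weakK_ge0.
Qed.

Lemma maj_set_has_sup g s : weakK g -> 0 < s -> has_sup (maj_set g s).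
Proof.
move=> gK s0; split; last by exists (g (2 * s)); exact: maj_set_ub.
by exists (g 0 * cutoff 0 s), 0 => /=.
Qed.

Lemma majorantE g s : 0 < s -> majorant g s = sup (maj_set g s).
Proof. by move=> s0; rewrite /majorant lt_geF. Qed.

Lemma majorant_ge g s : weakK g -> 0 <= s -> g s <= majorant g s.
Proof.
move=> gK; rewrite le_eqVlt => /predU1P[<-|s1].
  by rewrite /majorant lexx weakK_at0.
rewrite majorantE //.
apply: ub_le_sup; first by case: (maj_set_has_sup gK s1).
by exists s => /=; [exact: ltW|rewrite cutoff_id // mulr1].
Qed.

Lemma majorant_le g s : weakK g -> 0 <= s -> majorant g s <= g (2 * s).
Proof.
move=> gK; rewrite le_eqVlt => /predU1P[<-|s1].
  by rewrite /majorant lexx mulr0 weakK_at0.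
rewrite majorantE //.
apply: sup_le_ub; first by case: (maj_set_has_sup gK s1).
exact: maj_set_ub.
Qed.

Lemma majorant_mono g s t : weakK g -> 0 <= s -> s <= t -> majorant g s <= majorant g t.
Proof.
move=> gK; rewrite le_eqVlt => /predU1P[<- t0|s1 st].
  rewrite {1}/majorant lexx.
  by apply: le_trans (majorant_ge gK t0); exact: weakK_ge0.
have t1 := lt_le_trans s1 st.
rewrite !majorantE //; apply: sup_le_ub; first by case: (maj_set_has_sup gK s1).
move=> _ [r /= r0 <-]; apply: (@le_trans _ _ (g r * cutoff r t)).
  by apply: ler_wpM2l; [exact: weakK_ge0|exact: cutoff_le].
by apply: ub_le_sup; [case: (maj_set_has_sup gK t1)|exists r].
Qed.

(** In the KL bound time is a parameter of [g]; this turns monotonicity of the parameter into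
    monotonicity of the majorant. *)
Lemma majorant_le_fun g h s : weakK g -> weakK h -> (forall r, 0 <= r -> g r <= h r) ->
  majorant g s <= majorant h s.
Proof.
move=> gK hK gh; rewrite /majorant; case: (leP s 0) => // s1.
apply: sup_le_ub; first by case: (maj_set_has_sup gK s1).
move=> _ [r /= r0 <-]; apply: (@le_trans _ _ (h r * cutoff r s)).
  by apply: ler_wpM2r; [exact: cutoff_ge0|exact: gh].
by apply: ub_le_sup; [case: (maj_set_has_sup hK s1)|exists r].
Qed.

(** Only [r <= 2 M] contribute, since beyond that the weight at [s] vanishes. There
    [g r <= g (2 M)], and the weight changes by at most [r |t - s| / (s t) <= (2 M / m ^+ 2) |t -
    s|]. *)
Lemma majorant_lip g m M s t : weakK g -> 0 < m -> m <= s <= M -> m <= t <= M ->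
  majorant g s <= majorant g t + g (2 * M) * (2 * M / m ^+ 2) * `|t - s|.
Proof.
move=> gK m0 /andP[ms sM] /andP[mt tM].
have s0 := lt_le_trans m0 ms; have t0 := lt_le_trans m0 mt.
have M0 := lt_le_trans s0 sM; have M20 : 0 <= 2 * M by rewrite mulr_ge0 // ltW.
have gM : 0 <= g (2 * M) by exact: weakK_ge0.
have k0 : 0 <= g (2 * M) * (2 * M / m ^+ 2) * `|t - s|.
  by rewrite mulr_ge0 // mulr_ge0 // divr_ge0 // sqr_ge0.
rewrite [majorant g s]majorantE //; apply: sup_le_ub; first by case: (maj_set_has_sup gK s0).
move=> _ [r /= r0 <-]; have [rM|/ltW rM] := leP r (2 * M); last first.
  rewrite cutoff_eq0 ?mulr0 ?addr_ge0 //; first by apply: le_trans (majorant_ge gK (ltW t0)); exact/weakK_ge0/ltW.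
  by apply: le_trans rM; rewrite ler_pM2l.
have gr := weakK_ge0 gK r0.
apply: (@le_trans _ _ (g r * cutoff r t + g r * `|r / s - r / t|)).
  by rewrite -mulrDr ler_wpM2l // cutoff_lip.
apply: lerD.
  rewrite majorantE //.
  by apply: ub_le_sup; [case: (maj_set_has_sup gK t0)|exists r].
rewrite -mulrA; apply: ler_pM => //; first exact: weakK_le.
have -> : r / s - r / t = r * (t - s) / (s * t).
  by field; rewrite !gt_eqF.
rewrite !normrM normfV (ger0_norm r0) mulrAC; apply: ler_wpM2r => //.
rewrite normrM (gtr0_norm s0) (gtr0_norm t0); apply: ler_pM => //.
  by rewrite invr_ge0 mulr_ge0 // ltW.
by rewrite lef_pV2 ?posrE ?mulr_gt0 ?exprn_gt0 // expr2 ler_pM // ltW.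
Qed.

(** The linear term makes the monotonicity strict. Continuity at 0 comes from the bound by
    [g (2 s)], elsewhere from the Lipschitz estimate on [[s / 2, 2 s]]. *)
Lemma classK_majorant g c : weakK g -> 0 < c -> classK (fun s => majorant g s + c * s).
Proof.
move=> gK c0; split; last split.
- apply/within_continuousP => s e /= s0 e0; have e20 : 0 < e / 2 by rewrite divr_gt0.
  have [d1 d10 Hd1] : exists2 d, 0 < d & forall t, 0 <= t -> `|t - s| < d ->
      `|majorant g t - majorant g s| < e / 2.
    move: s0; rewrite le_eqVlt => /predU1P[<-|s0].
      have e40 : 0 < e / 4 by rewrite divr_gt0.
      have [_ _ /(_ _ e40)[d d0 Hd]] := gK; exists (d / 2); first by rewrite divr_gt0.
      move=> t t0; rewrite subr0 ger0_norm // => td; rewrite {2}/majorant lexx subr0.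
      rewrite ger0_norm; last by apply: le_trans (majorant_ge gK t0); exact: weakK_ge0.
      apply: le_lt_trans (majorant_le gK t0) _; apply: le_lt_trans (Hd _ _ _) _.
      + by rewrite mulr_ge0.
      + lra.
      + lra.
    pose K := g (2 * (2 * s)) * (2 * (2 * s) / (s / 2) ^+ 2).
    have K0 : 0 <= K.
      have s40 : 0 <= 2 * (2 * s) by rewrite !mulr_ge0 // ltW.
      by rewrite mulr_ge0 ?(weakK_ge0 gK) // divr_ge0 // sqr_ge0.
    have K10 : 0 < K + 1 by rewrite ltr_wpDl.
    exists (Num.min (s / 2) (e / 2 / (K + 1))).
      by rewrite lt_min !divr_gt0.
    move=> t t0; rewrite lt_min => /andP[ts]; rewrite ltr_pdivlMr // => tK.
    have s20 : 0 < s / 2 by rewrite divr_gt0.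
    have sI : s / 2 <= s <= 2 * s by apply/andP; split; lra.
    have tI : s / 2 <= t <= 2 * s.
      by move: ts; rewrite ltr_norml => /andP[]; move=> *; apply/andP; split; lra.
    have := majorant_lip gK s20 sI tI; have := majorant_lip gK s20 tI sI.
    rewrite -/K distrC => H1 H2.
    have tK' : K * `|t - s| < e / 2.
      apply: le_lt_trans tK; rewrite mulrC ler_wpM2l // lerDl //.
    move: H1 H2 tK'; rewrite ltr_norml; move=> *; apply/andP; split; lra.
  exists (Num.min d1 (e / 2 / c)); first by rewrite lt_min d10 divr_gt0.
  move=> t t0; rewrite lt_min => /andP[td1]; rewrite ltr_pdivlMr // => tc.
  rewrite opprD addrACA -mulrBr; apply: le_lt_trans (ler_normD _ _) _.
  by rewrite [e]splitr ltrD ?Hd1 // normrM gtr0_norm // mulrC.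
- move=> a b a0 ab; apply: ler_ltD; first exact/majorant_mono/ltW.
  by rewrite ltr_pM2l.
- by rewrite /majorant lexx mulr0 addr0.
Qed.

End Majorant.

(** * From stability and uniform attractivity to a KL estimate *)

Section KLBound.
Variables (R : realType) (Tr : Type) (len size0 inp : Tr -> R) (y : Tr -> R -> R).
Variables (P1 P2 P3 : R -> R).
Hypothesis size0_ge0 : forall p, 0 <= size0 p.
Hypothesis inp_ge0 : forall p, 0 <= inp p.
Hypothesis P1K : weakK P1.
Hypothesis P2K : weakK P2.
Hypothesis P3K : weakK P3.
Hypothesis stable : forall p t, 0 <= t <= len p -> y p t <= P1 (size0 p) + P2 (inp p).
Hypothesis attractive : forall r e : R, 0 < e -> exists tau, forall p t,
  size0 p <= r -> inp p <= r -> 0 <= t -> tau <= t -> t <= len p ->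
  y p t <= P3 (inp p) + e.
Implicit Types (r s t e : R) (p : Tr).

(** [P2] and [P3] are the input terms of the two hypotheses; [P1] is added so that an initial state
    smaller than the input is charged to the input. *)
Let P s := P1 s + P2 s + P3 s.
Let PK : weakK P. Proof. by do 2 apply: weakK_add => //. Qed.

(** The excess over the input term from time [t] on, for all inputs at once; its supremum [h r t] is
    the KL bound before regularisation. *)
Let E r t := [set z | z = 0 \/ exists p t',
  [/\ size0 p <= r, 0 <= t', t <= t', t' <= len p & z = y p t' - P (inp p)]].
Let h r t := sup (E r t).

Let E0 r t : E r t !=set0. Proof. by exists 0; left. Qed.

(** Attractivity is uniform only for inputs of norm at most [r]. This disposes of the others, whose
    norm exceeds the initial size. *)
Let excess_le0 p t : 0 <= t <= len p -> size0 p <= inp p -> y p t - P (inp p) <= 0.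
Proof.
move=> tT pp; rewrite subr_le0; apply: le_trans (stable tT) _.
rewrite /P -addrA; apply: lerD; first exact: weakK_le.
by rewrite lerDl weakK_ge0.
Qed.

Let Eub r t : 0 <= r -> ubound (E r t) (P1 r).
Proof.
move=> r0 z [->|[p [t' [pr t'0 tt tT ->]]]]; first exact: weakK_ge0.
have tT' : 0 <= t' <= len p by rewrite t'0.
have [pp|/ltW pp] := leP (size0 p) (inp p).
  by apply: le_trans (excess_le0 tT' pp) _; exact: weakK_ge0.
rewrite lerBlDr; apply: le_trans (stable tT') _.
apply: lerD; first exact: weakK_le.
by rewrite /P [P1 _ + _]addrC -addrA lerDl addr_ge0 // weakK_ge0.
Qed.

Let hs r t : 0 <= r -> has_sup (E r t).
Proof. by move=> r0; split=> //; exists (P1 r); exact: Eub. Qed.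

Let h_ge0 r t : 0 <= r -> 0 <= h r t.
Proof. by move=> r0; apply: ub_le_sup; [case: (hs t r0)|left]. Qed.

Let h_le r s t : 0 <= r -> r <= s -> h r t <= h s t.
Proof.
move=> r0 rs; have s0 := le_trans r0 rs.
apply: sup_le_ub => // z [->|[p [t' [pr t'0 tt tT ->]]]]; first exact: h_ge0.
apply: ub_le_sup; first by case: (hs t s0).
by right; exists p, t'; split => //; exact: le_trans rs.
Qed.

Let h_anti r s t : 0 <= r -> s <= t -> h r t <= h r s.
Proof.
move=> r0 st; apply: sup_le_ub => // z [->|[p [t' [pr t'0 tt tT ->]]]]; first exact: h_ge0.
apply: ub_le_sup; first by case: (hs s r0).
by right; exists p, t'; split => //; exact: le_trans tt.
Qed.

Let hK t : weakK (h^~ t).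
Proof.
split; first by move=> s; exact: h_ge0.
- by move=> a b; exact: h_le.
- move=> e e0; have [_ _ /(_ _ e0)[d d0 Hd]] := P1K; exists d => // s s0 sd.
  by apply: le_trans (Hd _ s0 sd); apply: sup_le_ub => //; exact: Eub.
Qed.

Let h_small r e : 0 <= r -> 0 < e -> exists tau, h r tau <= e.
Proof.
move=> r0 e0; have [tau Ht] := attractive r e0; exists tau.
apply: sup_le_ub => // z [->|[p [t' [pr t'0 tt tT ->]]]]; first exact: ltW.
have [pp|/ltW pp] := leP (inp p) r; last first.
  apply: le_trans (ltW e0); apply: excess_le0; first by rewrite t'0.
  exact: le_trans pp.
rewrite lerBlDr; apply: le_trans (Ht p t' pr pp t'0 tt tT) _.
by rewrite addrC lerD2l /P lerDr addr_ge0 // weakK_ge0.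
Qed.

Lemma KL_bound : exists b g, classKL b /\ classK g /\
  forall p t, 0 <= t <= len p -> y p t <= b (size0 p) t + g (inp p).
Proof.
(* The factor [(1 + t)^-1] lets the term that enforces strictness in [r] decay in [t]. *)
exists (fun r t => majorant (h^~ t) r + (1 + t)^-1 * r).
exists (fun r => majorant P r + 1 * r); split; last split.
- split=> [t t0|r r0].
    by apply: classK_majorant => //; rewrite invr_gt0 ltr_wpDr.
  split=> [s t s0 st|].
    have s1 : 0 < 1 + s by rewrite ltr_wpDr.
    have t1 : 0 < 1 + t by rewrite ltr_wpDr // (le_trans s0).
    apply: lerD; first by apply: majorant_le_fun => // q q0; exact: h_anti.
    by apply: ler_wpM2r => //; rewrite lef_pV2 // lerD2l.
  apply/cvgrPdist_le => e e0; have e20 : 0 < e / 2 by rewrite divr_gt0.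
  have r20 : 0 <= 2 * r by rewrite mulr_ge0.
  (* Taken at [2 * r] because the majorant at [r] is controlled by [h] at [2 * r]. *)
  have [tau Ht] := h_small r20 e20.
  exists (Num.max 0 (Num.max tau (r / (e / 2)))); split; first exact: num_real.
  move=> t; rewrite !gt_max => /and3P[t0 taut]; rewrite ltr_pdivrMr // => rt.
  have t1 : 0 < 1 + t by rewrite ltr_wpDl.
  rewrite sub0r normrN ger0_norm; last first.
    rewrite addr_ge0 // ?mulr_ge0 ?invr_ge0 ?(ltW t1) //.
    by apply: le_trans (majorant_ge (hK t) r0); exact: h_ge0.
  rewrite [e]splitr; apply: lerD.
    apply: le_trans (majorant_le (hK t) r0) _; apply: le_trans Ht.
    by apply: h_anti => //; exact: ltW.
  rewrite mulrC ler_pdivrMr // mulrDr mulr1; apply: le_trans (ltW rt) _.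
  by rewrite mulrC lerDr ltW.
- by apply: classK_majorant.
- move=> p t /andP[t0 tT]; rewrite addrACA.
  have yh : y p t <= h (size0 p) t + P (inp p).
    rewrite -lerBlDr; apply: ub_le_sup; first by case: (hs t (size0_ge0 p)).
    by right; exists p, t.
  apply: le_trans yh _; rewrite ler_wpDr //.
    by rewrite addr_ge0 ?mulr_ge0 // invr_ge0 addr_ge0.
  by apply: lerD; [exact: (majorant_ge (hK t))|exact: majorant_ge].
Qed.

End KLBound.

(** * Norms, essential suprema and translations *)

Section Norms.
Variable R : realType.

Lemma sum_sqr_le (I : finType) (a : I -> R) : (forall i, 0 <= a i) ->
  \sum_i a i ^+ 2 <= (\sum_i a i) ^+ 2.
Proof.
move=> a0; suff H (r : seq I) : \sum_(i <- r) a i ^+ 2 <= (\sum_(i <- r) a i) ^+ 2 by exact: H.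
elim: r => [|i r IH]; first by rewrite !big_nil expr0n.
rewrite !big_cons sqrrD -addrA lerD2l; apply: le_trans IH _.
by rewrite lerDr mulrn_wge0 // mulr_ge0 // sumr_ge0.
Qed.

Lemma sqrt_sum_sqr_le (I : finType) (a : I -> R) : (forall i, 0 <= a i) ->
  Num.sqrt (\sum_i a i ^+ 2) <= \sum_i a i.
Proof.
move=> a0; have s0 : 0 <= \sum_i a i by exact: sumr_ge0.
by rewrite -[leRHS](ger0_norm s0) -sqrtr_sqr ler_wsqrtr // sum_sqr_le.
Qed.

Lemma le_sqrt_sum_sqr (I : finType) (a : I -> R) i : 0 <= a i ->
  a i <= Num.sqrt (\sum_i a i ^+ 2).
Proof.
move=> a0; rewrite -[leLHS](ger0_norm a0) -sqrtr_sqr ler_wsqrtr //.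
by rewrite (bigD1 i) //= lerDl sumr_ge0 // => j _; exact: sqr_ge0.
Qed.

Lemma enorm_ge0 k (v : 'I_k -> R) : 0 <= enorm v.
Proof. exact: sqrtr_ge0. Qed.

Lemma enormE k (v : 'I_k -> R) : enorm v = Num.sqrt (\sum_l `|v l| ^+ 2).
Proof. by congr Num.sqrt; apply: eq_bigr => l _; rewrite real_normK ?num_real. Qed.

Lemma enorm_le_sum k (v : 'I_k -> R) : enorm v <= \sum_l `|v l|.
Proof. by rewrite enormE sqrt_sum_sqr_le. Qed.

Lemma coord_le_enorm k (v : 'I_k -> R) l : `|v l| <= enorm v.
Proof. by rewrite enormE (@le_sqrt_sum_sqr _ (fun l => `|v l|)). Qed.

Lemma enorm0 k : enorm (fun _ : 'I_k => 0 : R) = 0.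
Proof. by rewrite /enorm big1 ?sqrtr0 // => l _; rewrite expr0n. Qed.

Variables (n : nat) (N : 'I_n -> nat).

Lemma bnorm_ge0 (x : bvec R N) : 0 <= bnorm x.
Proof. exact: sqrtr_ge0. Qed.

Lemma bnormE (x : bvec R N) : bnorm x = Num.sqrt (\sum_i enorm (x i) ^+ 2).
Proof.
congr Num.sqrt; apply: eq_bigr => i _; rewrite sqr_sqrtr //.
by apply: sumr_ge0 => l _; exact: sqr_ge0.
Qed.

Lemma enorm_le_bnorm (x : bvec R N) i : enorm (x i) <= bnorm x.
Proof. by rewrite bnormE (@le_sqrt_sum_sqr _ (fun i => enorm (x i))) // enorm_ge0. Qed.

Lemma bnorm_le_sum (x : bvec R N) : bnorm x <= \sum_i enorm (x i).
Proof. by rewrite bnormE sqrt_sum_sqr_le // => i; exact: enorm_ge0. Qed.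

Lemma coord_le_bnorm (x : bvec R N) i l : `|x i l| <= bnorm x.
Proof. exact: le_trans (coord_le_enorm _ _) (enorm_le_bnorm _ _). Qed.

Lemma bnorm_le_sum_coord (x : bvec R N) : bnorm x <= \sum_i \sum_l `|x i l|.
Proof.
by apply: le_trans (bnorm_le_sum x) _; apply: ler_sum => i _; exact: enorm_le_sum.
Qed.

End Norms.

(** * Essential suprema and translation invariance *)

Section EssSup.
Variable R : realType.
Notation mu := (@lebesgue_measure R).
Implicit Types (g : R -> R) (c B : R).

Lemma lebesgue_setT_gt0 : (0 < mu [set: R])%E.
Proof. by rewrite -set_itvNyy lebesgue_measure_itv /= ltry. Qed.

Lemma esup_ge0 g : (forall t, 0 <= g t) -> (0 <= esup g)%E.
Proof. by move=> g0; apply: ess_sup_ger; [exact: lebesgue_setT_gt0|]. Qed.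

Lemma fine_esup_ge0 g : (forall t, 0 <= g t) -> 0 <= fine (esup g).
Proof. by move=> g0; apply: fine_ge0; exact: esup_ge0. Qed.

Lemma esup_le g B : (\forall t \ae mu, g t <= B) -> (esup g <= B%:E)%E.
Proof. by move=> gB; apply/ess_supP; move: gB; apply: (@filterS _ _ (ae_filter_ringOfSetsType mu)) => t; rewrite lee_fin. Qed.

Lemma fine_esup_le g B : (forall t, 0 <= g t) -> (\forall t \ae mu, g t <= B) ->
  fine (esup g) <= B.
Proof.
move=> g0 gB; have le := esup_le gB; have ge := esup_ge0 g0.
rewrite -lee_fin fineK // ge0_fin_numE //; exact: le_lt_trans le (ltry _).
Qed.

Lemma le_fine_esup g : (forall t, 0 <= g t) -> (esup g < +oo)%E ->
  \forall t \ae mu, g t <= fine (esup g).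
Proof.
move=> g0 gy; move: (ess_sup_ge mu (fun t => (g t)%:E)).
apply: (@filterS _ _ (ae_filter_ringOfSetsType mu)) => t.
by rewrite -lee_fin fineK // ge0_fin_numE // esup_ge0.
Qed.

Lemma measurable_I0t (t : R) : measurable (I0t t).
Proof. exact: measurable_itv. Qed.

Lemma measurable_shift c : measurable_fun [set: R] (fun t : R => t + c).
Proof. by apply: measurable_funD. Qed.

Lemma shift_preimage_itv (a b c : R) (ba bb : bool) :
  (fun t => t + c) @^-1` [set` Interval (BSide ba a) (BSide bb b)] =
  [set` Interval (BSide ba (a - c)) (BSide bb (b - c))].
Proof.
apply/seteqP; split => t /=; rewrite !itv_boundlr /=;
  by case: ba; case: bb; rewrite !bnd_simp /= ?lerBlDr ?lerBrDr ?ltrBlDr ?ltrBrDr.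
Qed.

(** The translated measure has the right value on intervals, and these determine Lebesgue
    measure. *)
Lemma lebesgue_measure_shift c (A : set R) : measurable A ->
  pushforward mu (fun t : R => t + c : measurableTypeR R) A = mu A.
Proof.
move=> mA; apply/esym.
have ms : measurable_fun [set: measurableTypeR R] (fun t : measurableTypeR R => t + c : measurableTypeR R).
  exact: measurable_shift.
pose phi : {mfun measurableTypeR R >-> measurableTypeR R} :=
  HB.pack (fun t : measurableTypeR R => t + c : measurableTypeR R)
    (isMeasurableFun.Build _ _ _ _ _ ms).
apply: (@lebesgue_measure_unique R (pushforward mu phi)) => //= _ [[a b]] _ <-.
rewrite /pushforward shift_preimage_itv !lebesgue_measure_itv /=.
by rewrite !lte_fin ltrD2r -!EFinD opprB addrA subrK.
Qed.

Lemma ae_shift c (P : R -> Prop) :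
  (\forall t \ae mu, P t) -> \forall t \ae mu, P (t + c).
Proof.
move=> [A [mA A0 PA]]; exists ((fun t => t + c) @^-1` A); split.
- by rewrite -[_ @^-1` _]setTI; exact: measurable_shift.
- by rewrite -A0 -(lebesgue_measure_shift c mA).
- by move=> t /= Pt; exact: PA.
Qed.

Lemma integral_shift c (D : set R) (g : R -> R) : measurable D ->
  mu.-integrable D (EFin \o g) ->
  mu.-integrable ((fun t : R => t + c) @^-1` D) (EFin \o (fun t => g (t + c))) /\
  (\int[mu]_(t in (fun t : R => (t + c)%R) @^-1` D) (g (t + c))%:E =
   \int[mu]_(t in D) (g t)%:E)%E.
Proof.
move=> mD /integrableP[mg intg].
have ms := measurable_shift c.
have mD' : measurable ((fun t : R => t + c) @^-1` D).
  by rewrite -[_ @^-1` _]setTI; exact: ms.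
have cg : measurable_fun ((fun t : R => t + c) @^-1` D) (EFin \o (fun t => g (t + c))).
  rewrite (_ : EFin \o _ = (EFin \o g) \o (fun t => t + c)) //.
  apply: (measurable_comp mD) => //; first by move=> _ [t /= Dt <-].
  exact: measurable_funTS.
have pE (h : R -> \bar R) : (\int[pushforward mu (fun t : R => (t + c)%R : measurableTypeR R)]_(y in D) h y
    = \int[mu]_(y in D) h y)%E.
  by apply: eq_measure_integral => A mA AD; exact: lebesgue_measure_shift.
have ige : mu.-integrable ((fun t : R => t + c) @^-1` D) (EFin \o (fun t => g (t + c))).
  apply/integrableP; split => //.
  apply: le_lt_trans intg; rewrite -pE ge0_integral_pushforward //.
  exact: measurableT_comp.
split => //.
(* The change of variables is applied to a function measurable on the whole line, so [g] is extended
   by 0 outside [D]. *)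
have mgr : measurable_fun [set: R] ((EFin \o g) \_ D).
  by apply/(measurable_restrict _ mD measurableT); rewrite setTI.
transitivity (\int[mu]_(t in (fun t : R => (t + c)%R) @^-1` D) (((EFin \o g) \_ D) \o (fun t => (t + c)%R)) t)%E.
  by apply: eq_integral => t /[!inE] /= Dt; rewrite patchE mem_set.
have ip : mu.-integrable ((fun t : R => t + c) @^-1` D)
    (((EFin \o g) \_ D) \o (fun t : R => t + c)).
  by apply: eq_integrable ige => // t /[!inE] /= Dt; rewrite patchE mem_set.
have ms' : measurable_fun [set: measurableTypeR R]
  (fun t : measurableTypeR R => t + c : measurableTypeR R) by exact: ms.
transitivity (\int[pushforward mu (fun t : R => (t + c)%R : measurableTypeR R)]_(y in D)
  (((EFin \o g) \_ D) y))%E.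
  by apply/esym; exact: (@integral_pushforward _ _ _ _ _ _ ms' mu D _ mgr ip mD).
by rewrite pE; apply: eq_integral => t Dt; rewrite patchE Dt.
Qed.

End EssSup.

(** * Solutions *)

Section Primitive.
Variable R : realType.
Notation mu := (@lebesgue_measure R).
Variables (T : R) (g z : R -> R).
Hypothesis T0 : 0 <= T.
Hypothesis zP : forall t : R, 0 <= t <= T -> mu.-integrable (I0t t) (EFin \o g) /\
  ((z t - z 0)%:E = \int[mu]_(s in I0t t) (g s)%:E)%E.
Implicit Types (s t : R).

Lemma primitiveE t : 0 <= t <= T -> z t = z 0 + \int[mu]_(s in `[0, t]%classic) g s.
Proof. by move=> /zP[_ zE]; rewrite /Rintegral -zE /= addrC subrK. Qed.

Lemma primitive_continuous : {within `[0, T]%classic, continuous z}.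
Proof.
have TT : 0 <= T <= T by rewrite T0 lexx.
have [ig _] := zP TT.
have /within_continuousP Pc := parameterized_integral_continuous T0 ig.
apply/within_continuousP => s e sT e0; have [d d0 Hd] := Pc s e sT e0.
exists d => // t tT ts; have := Hd t tT ts; move: sT tT.
rewrite /parameterized_integral /= !in_itv /= => sT tT.
by rewrite (primitiveE sT) (primitiveE tT) opprD addrACA subrr add0r.
Qed.

Lemma primitive_measurable : measurable_fun `[0, T]%classic z.
Proof.
by apply: subspace_continuous_measurable_fun => //; exact: primitive_continuous.
Qed.

Lemma primitive_bounded : exists B, forall t, 0 <= t <= T -> `|z t| <= B.
Proof.
have [c1 _ H1] := EVT_max T0 primitive_continuous.
have [c2 _ H2] := EVT_min T0 primitive_continuous.
exists (`|z c1| + `|z c2|) => t tT.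
have /H1 : t \in `[0, T] by rewrite in_itv.
have /H2 : t \in `[0, T] by rewrite in_itv.
have := ler_norm (z c1); have := ler_norm (- z c2); rewrite normrN.
have := normr_ge0 (z c1); have := normr_ge0 (z c2).
rewrite ler_norml => *; apply/andP; split; lra.
Qed.

(** The increment of [z] over [[s, t + s]] is the integral over that interval, moved back to
    [[0, t]] by translation. The form [z (0 + s)] is the initial value of the translated
    function. *)
Lemma primitive_shift s : 0 <= s <= T -> forall t, 0 <= t <= T - s ->
  mu.-integrable (I0t t) (EFin \o (fun r => g (r + s))) /\
  ((z (t + s) - z (0 + s))%:E = \int[mu]_(r in I0t t) (g (r + s))%:E)%E.
Proof.
move=> /andP[s0 sT] t /andP[t0 tT].
have tsT : 0 <= t + s <= T by rewrite addr_ge0 // -lerBrDr.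
have [ig zE] := zP tsT.
have itvE : `[0, t]%classic = (fun r => r + s) @^-1` `[s, t + s]%classic.
  by rewrite shift_preimage_itv subrr addrK.
have ig' : mu.-integrable `[s, t + s]%classic (EFin \o g).
  apply: integrableS ig; [exact: measurable_I0t|exact: measurable_itv|].
  move=> r; rewrite /I0t /= !in_itv /= => /andP[sr ->].
  by rewrite (le_trans s0).
have [ish shE] := integral_shift s (measurable_itv _) ig'.
rewrite /I0t itvE; split=> //; rewrite shE add0r.
rewrite (primitiveE tsT) (@primitiveE s) ?s0 // opprD addrACA subrr add0r.
rewrite (@Rintegral_itvB _ g (BLeft 0) (BRight (t + s)) s) //; last first.
  by rewrite bnd_simp lerDr.
rewrite Rintegral_itv_obnd_cbnd.
  by rewrite /Rintegral fineK //; exact: integrable_fin_num.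
by apply: integrableS ig' => //; exact: subset_itv_oc_cc.
Qed.

End Primitive.

(** * Blocks of a solution as subsystem trajectories *)

Section Blocks.
Variables (R : realType) (n : nat) (N m : 'I_n -> nat).
Variable f : forall i : 'I_n, bvec R N -> ('I_(m i) -> R) -> ('I_(N i) -> R).
Arguments f : clear implicits.
Notation mu := (@lebesgue_measure R).
Notation rhs u := (fun s y => fun i => f i y (u s i)).
Implicit Types (u : R -> bvec R m) (x : R -> bvec R N) (T s t : R).

Lemma bsol_bounded T x u i : 0 <= T -> is_bsol (rhs u) T x ->
  exists B, forall t, 0 <= t <= T -> enorm (x t i) <= B.
Proof.
move=> T0 xs.
have /choice[B HB] : forall l, exists B, forall t, 0 <= t <= T -> `|x t i l| <= B.
  by move=> l; apply: (@primitive_bounded _ T (fun s => f i (x s) (u s i) l)) => // t tT; exact: xs.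
exists (\sum_l B l) => t tT; apply: le_trans (enorm_le_sum _) _.
by apply: ler_sum => l _; exact: HB.
Qed.

Lemma bsol_shift T x u s : is_bsol (rhs u) T x -> 0 <= s <= T ->
  is_bsol (rhs (fun t => u (t + s))) (T - s) (fun t => x (t + s)).
Proof.
move=> xs sT t tT i l.
by apply: (@primitive_shift R T (fun s => f i (x s) (u s i) l) (fun t => x t i l)) tT =>
  // r rT; exact: xs.
Qed.

Lemma is_bLinf_shift u s : is_bLinf u -> is_bLinf (fun t => u (t + s)).
Proof.
move=> [mu_ uy]; split.
  move=> i l; rewrite (_ : (fun t => _) = (fun t => u t i l) \o (fun t => t + s)) //.
  by apply: measurableT_comp => //; exact: measurable_shift.
apply: le_lt_trans (ltry (blinf_norm u)); apply: esup_le.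
apply: (@ae_shift R s (fun t => bnorm (u t) <= blinf_norm u)).
by apply: le_fine_esup => // t; exact: bnorm_ge0.
Qed.

Lemma blinf_norm_shift_le u s : is_bLinf u ->
  blinf_norm (fun t => u (t + s)) <= blinf_norm u.
Proof.
move=> [_ uy]; apply: fine_esup_le => [t|]; first exact: bnorm_ge0.
apply: (@ae_shift R s (fun t => bnorm (u t) <= blinf_norm u)).
by apply: le_fine_esup => // t; exact: bnorm_ge0.
Qed.

Lemma blinf_norm_ge0 u : 0 <= blinf_norm u.
Proof. by apply: fine_esup_ge0 => t; exact: bnorm_ge0. Qed.

Variables (IS : {set 'I_n}) (beta : 'I_n -> R -> R -> R).
Variables (gam : 'I_n -> 'I_n -> R -> R) (gamu : 'I_n -> R -> R).
Hypothesis gamK : forall i j, weakK (gam i j).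
Hypothesis gamuK : forall i, weakK (gamu i).
Hypothesis iss : forall i, subsystem_ISS IS f i (beta i) (gam i) (gamu i).

Definition mixed_rhs i (b : 'I_n -> R) (p q : R) : R :=
  if i \in IS then p + Gam IS gam b i + q else Num.max p (Num.max (Gam IS gam b i) q).

Lemma mixed_rhs_le i b b' p q q' : (forall j, 0 <= b j) -> (forall j, b j <= b' j) ->
  q <= q' -> mixed_rhs i b p q <= mixed_rhs i b' p q'.
Proof.
move=> b0 bb' qq'; have GG := le_Gam IS gamK i b0 bb'.
rewrite /mixed_rhs; case: ifP => _; first by rewrite !lerD.
by rewrite !ge_max !le_max lexx GG qq' !orbT.
Qed.

(** The other blocks of the solution are fed to the [i]-th subsystem as inputs; the norms of their
    truncations are then at most the pointwise bounds [b]. *)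
Lemma block_estimate0 T x u t b i : 0 <= T -> is_bLinf u -> is_bsol (rhs u) T x ->
  0 <= t <= T -> (forall j, 0 <= b j) ->
  (forall j s, 0 <= s <= t -> enorm (x s j) <= b j) ->
  enorm (x t i) <= mixed_rhs i b (beta i (enorm (x 0 i)) t) (gamu i (blinf_norm u)).
Proof.
move=> T0 uL xs tT b0 xb.
(* Inputs live on the whole line, where [x] is uncontrolled outside [[0, T]]; extension by 0 makes
   it measurable and bounded. *)
pose w s : bvec R N := if (0 <= s) && (s <= T) then x s else fun _ _ => 0.
have wL j : is_Linf (fun s => w s j).
  split=> [l|].
    rewrite (_ : (fun s => _) = (fun s => x s j l) \_ `[0, T]%classic); last first.
      apply/funext => s; rewrite patchE /w; case: ifPn => sT.
        by rewrite mem_set //= in_itv.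
      by rewrite memNset //= in_itv; exact/negP.
    apply/(measurable_restrict _ (measurable_itv _) measurableT); rewrite setTI.
    by apply: (@primitive_measurable _ T (fun s => f j (x s) (u s j) l)) => // r rT; exact: xs.
  have [B HB] := bsol_bounded j T0 xs.
  apply: le_lt_trans (ltry (Num.max 0 B)); apply: esup_le; apply: nearW => s.
  rewrite /w le_max; case: ifPn => sT; first by rewrite HB ?orbT.
  by rewrite enorm0 lexx.
have xs' : is_sol (fun s y => f i (@dfwith _ (fun j : 'I_n => 'I_(N j) -> R) (w s) i y) (u s i)) T
    (fun s => x s i).
  move=> r rT l; have [ig xE] := xs r rT i l.
  have E s : I0t r s -> f i (@dfwith _ (fun j : 'I_n => 'I_(N j) -> R) (w s) i (x s i)) (u s i) l
      = f i (x s) (u s i) l.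
    rewrite /I0t /= in_itv /= => /andP[s0 sr]; congr (f _ _ _ _).
    have -> : w s = x s.
      by rewrite /w s0 (le_trans sr) //; case/andP : rT.
    apply/functional_extensionality_dep => j; case: dfwithP => //.
  split.
    by apply: eq_integrable ig => [|s /[!inE] Is]; [exact: measurable_I0t|rewrite E].
  by rewrite xE; apply: eq_integral => s /[!inE] Is; rewrite E.
have := iss wL uL T0 xs' tT => /le_trans; apply.
pose b' j := linf_norm (trunc 0 t (fun s => w s j)).
have b'0 j : 0 <= b' j by apply: fine_esup_ge0 => s; exact: enorm_ge0.
have b'b j : b' j <= b j.
  apply: fine_esup_le => [s|]; first exact: enorm_ge0.
  apply: nearW => s; rewrite /trunc; case: ifPn => [st|_]; last by rewrite enorm0.
  rewrite /w ifT; first exact: xb.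
  by move: st tT => /andP[-> /le_trans H] /andP[_ /H].
have := mixed_rhs_le i (beta i (enorm (x 0 i)) t) b'0 b'b (lexx (gamu i (blinf_norm u))).
by apply: le_trans; rewrite /mixed_rhs /Gam; case: ifP.
Qed.

(** Time enters the right-hand side only through [u], so translating by [s] again gives a solution,
    for a translated input of no larger norm. *)
Lemma block_estimate T x u s t b i : is_bLinf u -> is_bsol (rhs u) T x ->
  0 <= s -> s <= t -> t <= T -> (forall j, 0 <= b j) ->
  (forall j r, s <= r <= t -> enorm (x r j) <= b j) ->
  enorm (x t i) <= mixed_rhs i b (beta i (enorm (x s i)) (t - s)) (gamu i (blinf_norm u)).
Proof.
move=> uL xs s0 st tT b0 xb.
have sT : 0 <= s <= T by rewrite s0 (le_trans st).
have := @block_estimate0 (T - s) (fun r => x (r + s)) (fun r => u (r + s)) (t - s) b i.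
rewrite subrK add0r => H; apply: le_trans (H _ _ _ _ b0 _) _.
- by rewrite subr_ge0; case/andP : sT.
- exact: is_bLinf_shift.
- exact: bsol_shift.
- by rewrite subr_ge0 st lerD2r.
- move=> j r /andP[r0 rt]; apply: xb; rewrite lerDr r0 /=.
  by rewrite -lerBrDr.
- apply: mixed_rhs_le => //; apply: weakK_le => //; first exact: blinf_norm_ge0.
  exact: blinf_norm_shift_le.
Qed.

End Blocks.

(** * The ISS estimate for solutions on finite intervals *)

Section Interconnection.
Variables (R : realType) (n : nat) (N m : 'I_n -> nat).
Variable f : forall i : 'I_n, bvec R N -> ('I_(m i) -> R) -> ('I_(N i) -> R).
Arguments f : clear implicits.
Variables (IS : {set 'I_n}) (beta : 'I_n -> R -> R -> R).
Variables (gam : 'I_n -> 'I_n -> R -> R) (gamu : 'I_n -> R -> R) (alpha : R -> R).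
Hypothesis gamK : forall i j, classKinf0 (gam i j).
Hypothesis gamuK : forall i, classKinf0 (gamu i).
Hypothesis betaK : forall i, classKL (beta i).
Hypothesis alphaK : classKinf alpha.
Hypothesis small_gain : forall s : 'I_n -> R, (forall i, 0 <= s i) ->
  (exists i, s i != 0) -> exists i, Gam IS gam (Dalpha IS alpha s) i < s i.
Hypothesis iss : forall i, subsystem_ISS IS f i (beta i) (gam i) (gamu i).
Notation rhs u := (fun s y => fun i => f i y (u s i)).

Lemma interconnection_ISS : exists b g, classKL b /\ classK g /\
  forall (T : R) (u : R -> bvec R m) (x : R -> bvec R N), 0 <= T -> is_bLinf u ->
    is_bsol (rhs u) T x -> forall t : R, 0 <= t <= T ->
    bnorm (x t) <= b (bnorm (x 0)) t + g (blinf_norm u).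
Proof.
(* All solutions, for all inputs and all finite intervals, form a single family, so the resulting
   [b] and [g] depend on none of them. *)
pose Tr := {p : R * (R -> bvec R N) * (R -> bvec R m) |
  [/\ 0 <= p.1.1, is_bLinf p.2 & is_bsol (rhs p.2) p.1.1 p.1.2]}.
pose len (p : Tr) := (sval p).1.1; pose x (p : Tr) := (sval p).1.2.
pose u (p : Tr) := (sval p).2.
pose size0 p := bnorm (x p 0); pose inp p := blinf_norm (u p).
pose y p i t := enorm (x p t i).
have size0_ge0 p : 0 <= size0 p by exact: bnorm_ge0.
have inp_ge0 p : 0 <= inp p by exact: blinf_norm_ge0.
have y_ge0 p i t : 0 <= y p i t by exact: enorm_ge0.
have y_init p i : y p i 0 <= size0 p by exact: enorm_le_bnorm.
have y_bounded p i : exists B, forall t, 0 <= t <= len p -> y p i t <= B.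
  by case: p => p [T0 uL xs]; have [B HB] := bsol_bounded i T0 xs; exists B => t; exact: HB.
have gamwK i j : weakK (gam i j) by exact: classKinf0_weakK.
have gamuwK i : weakK (gamu i) by exact: classKinf0_weakK.
have y_est p i s t (b : 'I_n -> R) : 0 <= s -> s <= t -> t <= len p ->
    (forall j, 0 <= b j) -> (forall j r, s <= r <= t -> y p j r <= b j) ->
    y p i t <= if i \in IS then
               beta i (y p i s) (t - s) + Gam IS gam b i + gamu i (inp p)
             else Num.max (beta i (y p i s) (t - s))
                          (Num.max (Gam IS gam b i) (gamu i (inp p))).
  case: p => p [T0 uL xs] s0 st tT b0 yb.
  exact: (block_estimate gamwK gamuwK iss i uL xs s0 st tT b0 yb).
have PhiK := weakK_gain_bound gamwK alphaK.
have initK := weakK_init_bound betaK; have inpK := weakK_inp_bound gamuwK.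
have nK := @weakK_scale R n%:R (ler0n _ n); have twoK := @weakK_scale R 2 (ler0n _ 2).
have stable p t : 0 <= t <= len p -> bnorm (x p t) <=
    n%:R * gain_bound gam alpha (2 * init_bound beta (size0 p)) +
    n%:R * gain_bound gam alpha (2 * inp_bound gamu (inp p)).
  move=> tT; apply: le_trans (bnorm_le_sum _) _.
  rewrite -mulrDr mulr_natl -[X in _ *+ X](card_ord n) -sumr_const; apply: ler_sum => i _.
  exact: (global_stability gamK gamuwK betaK alphaK small_gain size0_ge0 inp_ge0
    y_ge0 y_init y_bounded y_est i tT).
have attractive r e : 0 < e -> exists tau, forall p t,
    size0 p <= r -> inp p <= r -> 0 <= t -> tau <= t -> t <= len p ->
    bnorm (x p t) <= n%:R * gain_bound gam alpha (inp_bound gamu (2 * inp p)) + e.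
  (* The norm is at most the sum of the [n] block norms, so each block gets a share of [e]. *)
  move=> e0; have e'0 : 0 < e / n.+1%:R by rewrite divr_gt0.
  have [tau H] := uniform_attractivity gamK gamuwK betaK alphaK small_gain size0_ge0 inp_ge0
    y_ge0 y_init y_bounded y_est r e'0.
  exists tau => p t pr pr' t0 taut tT; apply: le_trans (bnorm_le_sum _) _.
  apply: le_trans (_ : _ <= \sum_(i < n) (gain_bound gam alpha (inp_bound gamu (2 * inp p)) + e / n.+1%:R)) _.
    by apply: ler_sum => i _; exact: H.
  rewrite sumr_const card_ord -[leLHS]mulr_natl mulrDr lerD2l mulrCA ger_pMr //.
  by rewrite ler_pdivrMr ?ltr0Sn // mul1r ler_nat.
have P1K : weakK (fun r => n%:R * gain_bound gam alpha (2 * init_bound beta r)).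
  exact: weakK_comp nK (weakK_comp PhiK (weakK_comp twoK initK)).
have P2K : weakK (fun r => n%:R * gain_bound gam alpha (2 * inp_bound gamu r)).
  exact: weakK_comp nK (weakK_comp PhiK (weakK_comp twoK inpK)).
have P3K : weakK (fun r => n%:R * gain_bound gam alpha (inp_bound gamu (2 * r))).
  exact: weakK_comp nK (weakK_comp PhiK (weakK_comp inpK twoK)).
have [b [g [bK [gK H]]]] := KL_bound size0_ge0 inp_ge0 P1K P2K P3K stable attractive.
exists b, g; do 2 split => //; move=> T v z T0 vL zs t tT.
by have := H (exist _ (T, z, v) (And3 T0 vL zs)) t tT.
Qed.

End Interconnection.

(** * Caratheodory existence for bounded Lipschitz right-hand sides *)

Section MeasurableComp.
Variable R : realType.
Implicit Types (D : set R).

(* [G \o v] is the limit of its values at the grid points [floor ((k+1) v) / (k+1)]. *)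
Lemma measurable_fun_continuous_comp (I : finType) D (v : R -> I -> R) (G : (I -> R) -> R) :
  measurable D -> (forall i, measurable_fun D (fun s => v s i)) ->
  (forall p e, 0 < e -> exists2 d, 0 < d & forall q, (forall i, `|q i - p i| < d) ->
     `|G q - G p| < e) ->
  measurable_fun D (fun s => G (v s)).
Proof.
move=> mD mv Gc.
pose grid k (z : {ffun I -> int}) : I -> R := fun i => (z i)%:~R / k.+1%:R.
pose cell k s : {ffun I -> int} := [ffun i => Num.floor (k.+1%:R * v s i)].
have grid_near k s i : `|grid k (cell k s) i - v s i| <= k.+1%:R^-1.
  rewrite /grid /cell ffunE.
  have k0 : 0 < k.+1%:R :> R by rewrite ltr0Sn.
  have /andP[] := floor_itv (k.+1%:R * v s i); rewrite intrD.
  set z := _%:~R; move=> z1 z2.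
  have -> : z / k.+1%:R - v s i = - ((k.+1%:R * v s i - z) / k.+1%:R).
    by field; rewrite nat1r pnatr_eq0.
  rewrite normrN ger0_norm; last by rewrite divr_ge0 // subr_ge0.
  rewrite ler_pdivrMr // mulVf ?gt_eqF // lerBlDl; exact: ltW.
apply: (@measurable_fun_cvg _ _ _ _ (fun k s => G (grid k (cell k s)))).
  move=> k _ Y mY.
  (* The times spent in the grid cell [z], kept only if the value of [G] at its grid point lies in
     [Y]; as [I] is finite, there are countably many cells. *)
  pose A (z : {ffun I -> int}) := if `[< Y (G (grid k z)) >] then
    D `&` \big[setI/setT]_(i : I) (D `&` (fun s => v s i) @^-1`
      `[(z i)%:~R / k.+1%:R, (z i + 1)%:~R / k.+1%:R[%classic) else set0.
  have k0 : 0 < k.+1%:R :> R by rewrite ltr0Sn.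
  have cellP s i (z : int) : `[z%:~R / k.+1%:R, (z + 1)%:~R / k.+1%:R[%classic (v s i) <->
      Num.floor (k.+1%:R * v s i) = z.
    rewrite /= in_itv /= ler_pdivrMr // ltr_pdivlMr // mulrC.
    by split=> [/floor_def//|<-]; exact: floor_itv.
  rewrite (_ : _ `&` _ = \bigcup_z A z); last first.
    apply/seteqP; split => s.
      move=> [Ds Ys]; exists (cell k s) => //; rewrite /A asboolT //; split => //.
      by elim/big_ind : _ => // i _; split => //; apply/cellP; rewrite ffunE.
    move=> [z _]; rewrite /A; case: asboolP => // Yz [Ds As]; split => //=.
    suff -> : cell k s = z by [].
    apply/ffunP => i; rewrite ffunE; apply/cellP.
    by move: As; rewrite (bigD1 i) //= => -[[]].
  apply: countable_bigcupT_measurable; first exact: countableP.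
  move=> z; rewrite /A; case: ifP => // _; apply: measurableI => //.
  by apply: bigsetI_measurable => i _; apply: mv.
move=> s Ds; apply/cvgrPdist_lt => e e0.
have [d d0 Hd] := Gc (v s) e e0.
have [K KP] : exists K : nat, d^-1 < K%:R.
  by exists (Num.bound d^-1); apply: archi_boundP; rewrite invr_ge0 ltW.
exists K => // k /= Kk; rewrite distrC; apply: Hd => i.
apply: le_lt_trans (grid_near k s i) _.
rewrite -[d]invrK ltf_pV2 ?posrE ?invr_gt0 //; apply: lt_le_trans KP _.
by rewrite ler_nat leqW.
Qed.

End MeasurableComp.

(** * Picard iteration on the whole half-line *)

Section Picard.
Variables (R : realType) (I : finType) (F : R -> (I -> R) -> I -> R) (p0 : I -> R).
Variables (K L : R).
Notation mu := (@lebesgue_measure R).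
Implicit Types (x : R -> I -> R) (s t : R).
Hypothesis K0 : 0 <= K.
Hypothesis L1 : 1 <= L.
Hypothesis F_bounded : forall s p i, `|F s p i| <= K.
Hypothesis F_lipschitz : forall s p q (d : R) i, (forall j, `|p j - q j| <= d) ->
  `|F s p i - F s q i| <= L * d.
Hypothesis F_measurable : forall x, (forall i, measurable_fun [set: R] (fun s => x s i)) ->
  forall i, measurable_fun [set: R] (fun s => F s (x s) i).

Lemma bounded_integrable (g : R -> R) (a b B : R) (ba bb : bool) :
  measurable_fun [set: R] g -> (forall s, `|g s| <= B) ->
  mu.-integrable [set` Interval (BSide ba a) (BSide bb b)] (EFin \o g).
Proof.
move=> mg gB.
have fin : (mu [set` Interval (BSide ba a) (BSide bb b)] < +oo)%E.
  by rewrite lebesgue_measure_itv /=; case: ifP => // _; rewrite -EFinD ltry.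
apply: measurable_bounded_integrable fin _ _ => //; first exact: measurable_funTS.
exists B; split; first exact: num_real.
  by move=> c Bc s _; apply: le_trans (gB s) (ltW Bc).
Qed.

Lemma norm_Rintegral_le (g : R -> R) (a b B : R) (ba bb : bool) : a <= b ->
  measurable_fun [set: R] g ->
  (forall s, [set` Interval (BSide ba a) (BSide bb b)] s -> `|g s| <= B) ->
  mu.-integrable [set` Interval (BSide ba a) (BSide bb b)] (EFin \o g) ->
  `|\int[mu]_(s in [set` Interval (BSide ba a) (BSide bb b)]) g s| <= B * (b - a).
Proof.
move=> ab mg gB ig; apply: le_trans (le_normr_Rintegral _ ig) _ => //.
have := @bounded_integrable (cst B) a b `|B| ba bb; move=> /(_ _ _) iB.
apply: (@le_trans _ _ (\int[mu]_(s in [set` Interval (BSide ba a) (BSide bb b)]) cst B s)).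
  apply: le_Rintegral => //; first exact: (integrable_norm ig).
  by apply: iB => //; exact: measurable_cst.
have -> : \int[mu]_(s in [set` Interval (BSide ba a) (BSide bb b)]) cst B s =
    B * fine (mu [set` Interval (BSide ba a) (BSide bb b)]) by exact: Rintegral_cst.
rewrite lebesgue_measure_itv /= lte_fin; case: ifPn => [_|].
  by rewrite -EFinD.
rewrite -leNgt => ba'; have -> : a = b by apply/le_anti; rewrite ab.
by rewrite subrr mulr0.
Qed.

Definition prim (g : R -> R) t : R := \int[mu]_(s in I0t t) g s.

Lemma prim_neg g t : t < 0 -> prim g t = 0.
Proof.
move=> t0; rewrite /prim (_ : I0t t = set0) ?Rintegral_set0 //.
by apply/seteqP; split => // s; rewrite /I0t /= in_itv /= => /andP[/le_trans H /H]; rewrite leNgt t0.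
Qed.

Lemma prim_lipschitz (g : R -> R) s t : measurable_fun [set: R] g ->
  (forall s, `|g s| <= K) -> s <= t -> `|prim g t - prim g s| <= K * (t - s).
Proof.
move=> mg gK st; have [t0|t0] := ltP t 0.
  rewrite !prim_neg // ?(le_lt_trans st) // subrr normr0 mulr_ge0 // subr_ge0 //.
have [s0|s0] := ltP s 0.
  rewrite (prim_neg _ s0) subr0.
  apply: le_trans (norm_Rintegral_le t0 mg _ _) _ => //; first exact: bounded_integrable mg gK.
  by rewrite ler_wpM2l // lerD2l lerN2 ltW.
rewrite /prim /I0t (@Rintegral_itvB _ g (BLeft 0) (BRight t) s) //.
- apply: norm_Rintegral_le => //; exact: bounded_integrable mg gK.
- exact: bounded_integrable mg gK.
Qed.

Lemma measurable_prim (g : R -> R) : measurable_fun [set: R] g ->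
  (forall s, `|g s| <= K) -> measurable_fun [set: R] (prim g).
Proof.
move=> mg gK; apply: continuous_measurable_fun => s.
apply/cvgrPdist_lt => e e0; apply/nbhs_ballP; exists (e / (K + 1)) => /=.
  by rewrite divr_gt0 // ltr_wpDl.
move=> t; rewrite /ball /= ltr_pdivlMr ?ltr_wpDl // => st.
apply: le_lt_trans st; apply: le_trans (_ : _ <= K * `|s - t|) _; last first.
  by rewrite mulrC ler_wpM2l // lerDl.
have [ts|/ltW ts] := leP t s.
  by rewrite (ger0_norm (_ : 0 <= s - t)) ?subr_ge0 // prim_lipschitz.
by rewrite distrC (distrC s) (ger0_norm (_ : 0 <= t - s)) ?subr_ge0 // prim_lipschitz.
Qed.

Lemma prim_expR (a t : R) : 0 < t -> 
  \int[mu]_(s in I0t t) (a * expR (a * s)) = expR (a * t) - 1.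
Proof.
move=> t0.
have dF s : is_derive s 1 (fun s : R => expR (a * s)) (a * expR (a * s)).
  have h1 : is_derive s 1 (fun s : R => a * s) a.
    by apply: is_derive_eq; rewrite mulr1 || rewrite /GRing.scale /= mulr1.
  have := is_derive1_comp (is_derive_expR (a * s)) h1.
  by rewrite mulrC.
have cF : continuous (fun s : R => expR (a * s)).
  move=> s; apply/differentiable_continuous/derivable1_diffP; by case: (dF s).
have cf : continuous (fun s : R => a * expR (a * s)).
  by move=> s; apply: cvgMr; exact: cF.
rewrite /Rintegral (@continuous_FTC2 _ _ (fun s : R => expR (a * s)) _ _ t0).
- by rewrite mulr0 expR0.
- exact: continuous_subspaceT.
- split => [s _||]; first by case: (dF s).
    by apply: cvg_at_right_filter; exact: cF.
  by apply: cvg_at_left_filter; exact: cF.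
- by move=> s _; rewrite derive1E; exact: derive_val.
Qed.

(** With [h k] twice [h k.+1] and steps of length at most [h k.+1], the intervals
    [[z k - h k, z k + h k]] are nested; the supremum of their left ends lies in all of them. *)
Lemma geometric_limit (z : nat -> R) (C : R) :
  (forall k, `|z k.+1 - z k| <= C * 2^-1 ^+ k) ->
  exists l, forall k, `|l - z k| <= 2 * C * 2^-1 ^+ k.
Proof.
move=> zC; pose h k : R := 2 * C * 2^-1 ^+ k.
have hS k : h k.+1 = C * 2^-1 ^+ k by rewrite /h exprS; field.
have hk k : h k = 2 * h k.+1 by rewrite hS /h mulrA.
have h0 k : 0 <= h k by rewrite hk hS mulr_ge0 // (le_trans (normr_ge0 _) (zC k)).
have up j k : (j <= k)%N -> z k + h k <= z j + h j /\ z j - h j <= z k - h k.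
  move=> /subnK <-; elim: (k - j)%N => // d [IH1 IH2]; rewrite addSn.
  have := zC (d + j)%N; rewrite -hS ler_norml; have := hk (d + j)%N.
  move: IH1 IH2; set a := z (d + j)%N; set b := z _; set c := h (d + j)%N; set e := h _.
  by move=> ? ? ? /andP[? ?]; split; lra.
have bd j k : z j - h j <= z k + h k.
  have [jk|/ltnW kj] := leqP j k.
    by have [_] := up _ _ jk; have := h0 k; lra.
  by have [+ _] := up _ _ kj; have := h0 j; lra.
pose E := [set z k - h k | k in [set: nat]].
have Es : has_sup E.
  split; first by exists (z 0%N - h 0%N), 0%N.
  by exists (z 0%N + h 0%N) => _ [k _ <-]; exact: bd.
exists (sup E) => k; rewrite -/(h k) ler_norml.
have l1 : z k - h k <= sup E by apply: ub_le_sup; [case: Es|exists k].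
have l2 : sup E <= z k + h k.
  by apply: ge_sup; [case: Es|move=> _ [j _ <-]; exact: bd].
by apply/andP; split; lra.
Qed.

Lemma small_half_power (C e : R) : 0 < e -> exists k, C * 2^-1 ^+ k < e.
Proof.
move=> e0; have C1 : 0 < `|C| + 1 by rewrite ltr_wpDl.
have h1 : `|2^-1| < 1 :> R by rewrite gtr0_norm ?invr_gt0 // invf_lt1 // ltr1n.
have /cvgrPdist_lt/(_ (e / (`|C| + 1))) := cvg_expr h1.
move=> /(_ (divr_gt0 e0 C1))[k _ /(_ k)] /=; rewrite leqnn => /(_ isT).
rewrite sub0r normrN ltr_pdivlMr // => H; exists k; apply: le_lt_trans H.
apply: le_trans (ler_norm _) _; rewrite normrM mulrC ler_wpM2l // lerDl //.
Qed.

Fixpoint picard k : R -> I -> R :=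
  if k is k'.+1 then fun t i => p0 i + prim (fun s => F s (picard k' s) i) t
  else fun _ => p0.

Lemma picardS k t i : picard k.+1 t i = p0 i + prim (fun s => F s (picard k s) i) t.
Proof. by []. Qed.

Lemma measurable_picard k i : measurable_fun [set: R] (fun t => picard k t i).
Proof.
elim: k i => [|k IH] i /=; first exact: measurable_cst.
apply: measurable_funD; first exact: measurable_cst.
by apply: measurable_prim => //; exact: F_measurable.
Qed.

(** An exponentially weighted estimate: integrating [L * expR (2 * L * s)] gives at most half of
    [expR (2 * L * t)]. Each iteration thus gains a factor 1/2 at all times simultaneously, with no
    subdivision of the time interval. *)
Lemma picard_diff k t i :
  `|picard k.+1 t i - picard k t i| <= K * expR (2 * L * t) * 2^-1 ^+ k.
Proof.
have neg k' j r : r < 0 -> picard k' r j = p0 j.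
  by case: k' => //= k' r0; rewrite prim_neg // addr0.
have L0 : 0 < L by rewrite (lt_le_trans ltr01).
have [t0|t0] := ltP t 0.
  by rewrite !neg // subrr normr0 !mulr_ge0 ?expR_ge0 // exprn_ge0.
elim: k t t0 i => [|k IH] t t0 i.
  rewrite expr0 mulr1 /= addrAC subrr add0r.
  have mF0 : measurable_fun [set: R] (fun s => F s p0 i).
    by apply: (F_measurable (x := fun=> p0)) => j; exact: measurable_cst.
  have iF0 : mu.-integrable (I0t t) (EFin \o (fun s => F s p0 i)).
    by apply: (bounded_integrable _ _ _ _ mF0 (B := K)).
  apply: le_trans (norm_Rintegral_le t0 mF0 _ iF0) _ => [s _|]; first exact: F_bounded.
  (* Here [t <= 1 + 2 * L * t <= expR (2 * L * t)], using [1 <= L]. *)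
  rewrite subr0 ler_wpM2l //; apply: le_trans (expR_ge1Dx _).
  have : t <= L * t by rewrite ler_peMl.
  lra.
have mF k' : measurable_fun [set: R] (fun s => F s (picard k' s) i).
  by apply: F_measurable => j; exact: measurable_picard.
have iF k' : mu.-integrable (I0t t) (EFin \o (fun s => F s (picard k' s) i)).
  by apply: (bounded_integrable _ _ _ _ (mF k') (B := K)).
rewrite (picardS k.+1) (picardS k) opprD addrACA subrr add0r.
rewrite /prim -RintegralB //; last exact: measurable_I0t.
have [->|/eqP tn0] := eqVneq t 0.
  rewrite /I0t set_itv1 Rintegral_set1 normr0 !mulr_ge0 ?expR_ge0 // exprn_ge0 //.
have tp : 0 < t by rewrite lt_neqAle t0 eq_sym; move/eqP: tn0 => ->.
have ce : continuous (fun s : R => 2 * L * expR (2 * L * s)).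
  move=> s; apply: cvgMr; apply: (@continuous_comp _ _ _ (fun s : R => 2 * L * s) expR).
    by apply: cvgMr; exact: cvg_id.
  exact: continuous_expR.
pose c := K * 2^-1 ^+ k.+1.
have c0 : 0 <= c by rewrite mulr_ge0 // exprn_ge0.
have ie : mu.-integrable (I0t t) (EFin \o (fun s : R => 2 * L * expR (2 * L * s))).
  apply: continuous_compact_integrable; first exact: segment_compact.
  exact: continuous_subspaceT.
have iB : mu.-integrable (I0t t) (EFin \o (fun s => F s (picard k.+1 s) i - F s (picard k s) i)).
  rewrite (_ : EFin \o _ = (EFin \o (fun s => F s (picard k.+1 s) i)) \- (EFin \o (fun s => F s (picard k s) i)))%E //.
  by apply: integrableB => //; exact: measurable_I0t.
apply: le_trans (le_normr_Rintegral _ iB) _; first exact: measurable_I0t.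
apply: le_trans (_ : _ <= \int[mu]_(s in I0t t) (c * (2 * L * expR (2 * L * s)))) _.
  apply: le_Rintegral.
  - exact: measurable_I0t.
  - exact: (integrable_norm iB).
  - rewrite (_ : EFin \o _ = fun s => (c%:E * (EFin \o (fun s : R => (2 * L * expR (2 * L * s))%R)) s)%E) //.
    by apply: integrableZl => //; exact: measurable_I0t.
  - move=> s; rewrite /I0t /= in_itv /= => /andP[s0 st].
    apply: le_trans (F_lipschitz _ _ (IH s s0)) _.
    by rewrite /c exprS le_eqVlt; apply/orP; left; apply/eqP; field.
rewrite RintegralZl //; last exact: measurable_I0t.
have -> : K * expR (2 * L * t) * 2^-1 ^+ k.+1 = c * expR (2 * L * t) by rewrite /c mulrAC.
by rewrite prim_expR // ler_wpM2l // lerBlDr lerDl.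
Qed.

Lemma picard_solution : exists x, [/\ forall i, x 0 i = p0 i,
  forall i, measurable_fun [set: R] (fun t => x t i) &
  forall t i, 0 <= t -> x t i = p0 i + prim (fun s => F s (x s) i) t].
Proof.
have /choice[x xP] : forall ti : R * I, exists l, forall k,
    `|l - picard k ti.1 ti.2| <= 2 * (K * expR (2 * L * ti.1)) * 2^-1 ^+ k.
  by move=> [t i]; apply: geometric_limit => k /=; exact: picard_diff.
pose z t i := x (t, i).
have zP t i k : `|z t i - picard k t i| <= 2 * (K * expR (2 * L * t)) * 2^-1 ^+ k.
  exact: (xP (t, i) k).
have mz i : measurable_fun [set: R] (fun t => z t i).
  apply: (@measurable_fun_cvg _ _ _ _ (fun k t => picard k t i)).
    by move=> k; exact: measurable_picard.
  move=> t _; apply/cvgrPdist_lt => e e0.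
  have [k Hk] := small_half_power (2 * (K * expR (2 * L * t))) e0.
  exists k => // j /= kj; apply: le_lt_trans (zP t i j) _; apply: le_lt_trans Hk.
  apply: ler_wpM2l; first by rewrite !mulr_ge0 // expR_ge0.
  by apply: ler_wiXn2l => //; rewrite ?invr_ge0 // invf_le1 // ler1n.
have mF (y : R -> I -> R) i t : (forall i, measurable_fun [set: R] (fun t => y t i)) ->
    mu.-integrable (I0t t) (EFin \o (fun s => F s (y s) i)).
  by move=> my; apply: (bounded_integrable _ _ _ _ (F_measurable my i) (B := K)).
have zE t i : 0 <= t -> z t i = p0 i + prim (fun s => F s (z s) i) t.
  move=> t0; have L0 : 0 < L by rewrite (lt_le_trans ltr01).
  apply/eqP; rewrite -subr_eq0 -normr_le0; apply/ler_addgt0Pr => e e0; rewrite add0r.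
  pose C := 2 * (K * expR (2 * L * t)).
  have C0 : 0 <= C by rewrite !mulr_ge0 // expR_ge0.
  (* [C] bounds the distance from [z] to the iterate [k + 1], and [L * C * t] that between the
     integrals along [z] and along the iterate [k]. *)
  have [k Hk] := small_half_power (C + L * C * t) e0.
  have h1 := zP t i k.+1.
  have h2 : `|prim (fun s => F s (z s) i) t - prim (fun s => F s (picard k s) i) t|
      <= L * (C * 2^-1 ^+ k) * t.
    have iz := mF z i t mz; have ip := mF (picard k) i t (measurable_picard k).
    rewrite /prim -RintegralB //; last exact: measurable_I0t.
    rewrite -[X in _ * X]subr0; apply: norm_Rintegral_le => //.
    - apply: measurable_funB; first exact: F_measurable.
      by apply: F_measurable => j; exact: measurable_picard.
    - move=> s; rewrite /= in_itv /= => /andP[s0 st]; apply: F_lipschitz => j.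
      apply: le_trans (zP s j k) _; rewrite ler_wpM2r ?exprn_ge0 //.
      by rewrite ler_pM2l // ler_wpM2l // ler_expR ler_pM2l // mulr_gt0.
    - rewrite (_ : EFin \o _ = (EFin \o (fun s => F s (z s) i)) \- (EFin \o (fun s => F s (picard k s) i)))%E //.
      by apply: integrableB => //; exact: measurable_I0t.
  have -> : z t i - (p0 i + prim (fun s => F s (z s) i) t) =
      (z t i - picard k.+1 t i) -
      (prim (fun s => F s (z s) i) t - prim (fun s => F s (picard k s) i) t).
    by rewrite /=; ring.
  apply: le_trans (ler_normB _ _) _; apply: ltW; apply: le_lt_trans Hk.
  rewrite mulrDl; apply: lerD; last first.
    by apply: le_trans h2 _; rewrite le_eqVlt; apply/orP; left; apply/eqP; ring.
  apply: le_trans h1 _; rewrite -/C ler_wpM2l // exprS ler_piMl ?exprn_ge0 //.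
  by rewrite invf_le1 // ler1n.
exists z; split => // i; rewrite zE // /prim /I0t set_itv1 Rintegral_set1 addr0 //.
Qed.

End Picard.

(** * Uniform bounds on boxes *)

Section Box.
Variable R : realType.
Implicit Types (M d L : R).

(** Compactness of the cube in covering form: near each point all [L] above a local threshold work,
    so one threshold works everywhere. Functions on [J] are read as row vectors. *)
Lemma box_uniform (J : finType) M (P : R -> (J -> R) -> Prop) :
  (forall p, (forall j, `|p j| <= M) -> exists2 d, 0 < d & exists L0, forall q L,
     (forall j, `|q j - p j| < d) -> L0 < L -> P L q) ->
  exists2 L, 1 <= L & forall p, (forall j, `|p j| <= M) -> P L p.
Proof.
move=> loc; pose conv (v : 'rV[R]_#|J|) : J -> R := fun j => v ord0 (enum_rank j).
have cpt : compact [set v : 'rV[R]_#|J| | forall i, `[- M, M]%classic (v ord0 i)].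
  by apply: (@rV_compact R #|J| (fun=> `[- M, M]%classic)) => i; exact: segment_compact.
have /compact_near_coveringP/(_ _ (pinfty_nbhs R) (fun L v => P L (conv v)) _) H := cpt.
have [|L0 [_ HL]] := H.
  move=> v vM; have [|d d0 [L0 Hd]] := loc (conv v).
    by move=> j; rewrite ler_norml; have := vM (enum_rank j); rewrite /= in_itv.
  exists (ball v d, [set L | L0 < L]).
    split; first exact: nbhsx_ballx.
    by exists L0; split; [exact: num_real|].
  move=> [w L] /= [[_ bw] LL]; apply: Hd => // j.
  by rewrite distrC; exact: bw.
exists (Num.max 1 (L0 + 1)); first by rewrite le_max lexx.
move=> p pM; have -> : p = conv (\row_i p (enum_val i)).
  by apply/funext => j; rewrite /conv mxE enum_rankK.
apply: HL => /=; first by rewrite lt_max ltrDl ltr01 orbT.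
by move=> i; rewrite in_itv /= mxE -ler_norml.
Qed.

Definition clip M (a : R) : R := Num.max (- M) (Num.min M a).

Lemma clip_bound M a : 0 <= M -> `|clip M a| <= M.
Proof.
by move=> M0; rewrite /clip ler_norml le_max lexx ge_max ge_min lexx /= andbT; lra.
Qed.

Lemma clip_id M a : `|a| <= M -> clip M a = a.
Proof.
by rewrite ler_norml => /andP[Ma aM]; rewrite /clip (min_idPr aM) (max_idPr Ma).
Qed.

Lemma clip_lip M a b : `|clip M a - clip M b| <= `|a - b|.
Proof.
rewrite /clip; have := ler_norm (a - b); have := ler_norm (b - a); rewrite distrC.
have := normr_ge0 (a - b); rewrite ler_norml !minEle !maxEle => ? ? ?.
by apply/andP; split; do !case: ifPn; rewrite -?ltNge; lra.
Qed.

Definition dimsum n (N : 'I_n -> nat) : R := \sum_(i < n) \sum_(l < N i) 1.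

Lemma dimsum_ge0 n (N : 'I_n -> nat) : 0 <= dimsum N.
Proof. by do 2 apply: sumr_ge0 => ? _. Qed.

Lemma bnorm_le_dimsum n (N : 'I_n -> nat) (x : bvec R N) d :
  (forall i l, `|x i l| <= d) -> bnorm x <= dimsum N * d.
Proof.
move=> xd; apply: le_trans (bnorm_le_sum_coord x) _.
rewrite /dimsum mulr_suml; apply: ler_sum => i _; rewrite mulr_suml.
by apply: ler_sum => l _; rewrite mul1r.
Qed.

Lemma enorm_le_dim k (v : 'I_k -> R) d : (forall l, `|v l| <= d) -> enorm v <= k%:R * d.
Proof.
move=> vd; apply: le_trans (enorm_le_sum v) _.
apply: le_trans (_ : _ <= \sum_(l < k) d) _; first exact: ler_sum.
by rewrite sumr_const card_ord mulr_natl.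
Qed.

End Box.

(** Flattening the blocks into one finite index set lets the compactness and Picard results for
    functions on a finite type apply. *)
Definition state_index n (N : 'I_n -> nat) : finType := {i : 'I_n & 'I_(N i)}.

Definition to_bvec (R : realType) n (N : 'I_n -> nat) (q : state_index N -> R) : bvec R N :=
  fun i l => q (existT _ i l).
Arguments to_bvec {R n N} q i l.

(** * Bounds and Lipschitz constants of the right-hand side on boxes *)

Section RhsBounds.
Variables (R : realType) (n : nat) (N : 'I_n -> nat) (mi Ni : nat).
Variable g : bvec R N -> ('I_mi -> R) -> ('I_Ni -> R).
Hypothesis g_cont : rhs_continuous g.
Hypothesis g_lip : rhs_loc_lip g.
Implicit Types (x y : bvec R N) (u : 'I_mi -> R) (M U d e : R).

Lemma rhs_continuous_coord x u e : 0 < e -> exists2 d, 0 < d & forall y v,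
  (forall i l, `|y i l - x i l| < d) -> (forall l, `|v l - u l| < d) ->
  forall l, `|g y v l - g x u l| < e.
Proof.
move=> e0; have [d [d0 Hd]] := g_cont x u e0.
pose c := dimsum R N + mi%:R + 1.
have c0 : 0 < c by rewrite ltr_wpDl // addr_ge0 // dimsum_ge0.
have cd : 0 < d / c by rewrite divr_gt0.
exists (d / c) => // y v yx vu l.
have le a : 0 <= a -> a < c -> a * (d / c) < d.
  by move=> a0 ac; rewrite mulrCA gtr_pMr // ltr_pdivrMr // mul1r.
apply: le_lt_trans (coord_le_enorm (vsub (g y v) (g x u)) l) _; apply: Hd.
  apply: le_lt_trans (bnorm_le_dimsum (d := d / c) _) _.
    by move=> i k; apply/ltW/yx.
  by apply: le; [exact: dimsum_ge0|rewrite /c -addrA ltrDl ltr_wpDl].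
apply: le_lt_trans (enorm_le_dim (d := d / c) _) _.
  by move=> k; apply/ltW/vu.
by apply: le => //; rewrite /c; have := dimsum_ge0 R N; lra.
Qed.

Lemma rhs_bounded_on_box M U : exists2 K, 1 <= K & forall x u,
  (forall i l, `|x i l| <= M) -> (forall l, `|u l| <= U) -> forall l, `|g x u l| <= K.
Proof.
pose P (K : R) (q : state_index N + 'I_mi -> R) :=
  forall l, `|g (to_bvec (fun j => q (inl j))) (fun j => q (inr j)) l| <= K.
have [|K K1 HK] := @box_uniform R _ (Num.max M U) P; last first.
  exists K => // x u xM uU l.
  have := HK (fun j => match j with inl j => x (tag j) (tagged j) | inr j => u j end).
  by apply => -[[i k]|k] /=; rewrite le_max ?xM ?uU ?orbT.
move=> p pM; set x := to_bvec (fun j => p (inl j)); set u := fun j => p (inr j).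
have [d d0 Hd] := rhs_continuous_coord x u ltr01.
exists d => //; exists (enorm (g x u) + 1) => q L qp gL l.
have H := Hd (to_bvec (fun j => q (inl j))) (fun j => q (inr j)).
have {}H : `|g (to_bvec (fun j => q (inl j))) (fun j => q (inr j)) l - g x u l| < 1.
  by apply: H => [i k|k]; exact: qp.
apply/ltW/(le_lt_trans _ gL).
have := ler_normD (g (to_bvec (fun j => q (inl j))) (fun j => q (inr j)) l - g x u l) (g x u l).
rewrite subrK; have := coord_le_enorm (g x u) l; lra.
Qed.

(** Compactness controls only pairs closer than [L^-1], as the local Lipschitz property is local in
    both points. For [d >= L^-1] boundedness takes over: the difference is at most
    [2 * K <= 2 * K * L * d], whence the final constant. *)
Lemma rhs_lipschitz_on_box M U : exists2 L, 1 <= L & forall x y u d,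
  (forall i l, `|x i l| <= M) -> (forall i l, `|y i l| <= M) -> (forall l, `|u l| <= U) ->
  0 <= d -> (forall i l, `|x i l - y i l| <= d) ->
  forall l, `|g x u l - g y u l| <= L * d.
Proof.
have [K K1 HK] := rhs_bounded_on_box M U.
pose P (L : R) (q : state_index N -> R) := forall y u d, (forall l, `|u l| <= U) ->
  0 <= d -> d < L^-1 -> (forall i l, `|to_bvec q i l - y i l| <= d) ->
  forall l, `|g (to_bvec q) u l - g y u l| <= L * d.
have [|L L1 HL] := @box_uniform R _ M P.
  move=> p pM; have [d [L0 [d0 Hd]]] := g_lip (mi%:R * U) (to_bvec p).
  have C0 := dimsum_ge0 R N; set C := dimsum R N in C0.
  have C1 : 0 < C + 1 by lra.
  (* Halved because [y] is within [d'] of [q], which is within [d'] of [p]; [C + 1] converts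
     coordinate bounds to norms. *)
  pose d' := d / (C + 1) / 2; have d'0 : 0 < d' by rewrite !divr_gt0.
  have near z : (forall i l, `|z i l - to_bvec p i l| <= d' + d') ->
      bnorm (bsub z (to_bvec p)) < d.
    move=> zp; apply: le_lt_trans (bnorm_le_dimsum (d := d' + d') _) _; first exact: zp.
    by rewrite /d' -splitr mulrCA gtr_pMr // ltr_pdivrMr // mul1r ltrDl.
  exists d' => //; exists (Num.max d'^-1 (`|L0| * C)) => q L qp.
  rewrite gt_max => /andP[Ld LC] y u e uU e0 eL qy l.
  have L0' : 0 < L by apply: lt_trans Ld; rewrite invr_gt0.
  have ed' : e < d' by apply: lt_trans eL _; rewrite -[d']invrK ltf_pV2 // posrE invr_gt0.
  apply: le_trans (coord_le_enorm (vsub (g (to_bvec q) u) (g y u)) l) _.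
  apply: le_trans (Hd _ _ _ _ _ _) _.
  - by apply: near => i k; have := qp (existT _ i k); rewrite /to_bvec; lra.
  - apply: near => i k; have := qp (existT _ i k); have := qy i k.
    rewrite distrC; have := ler_normD (y i k - to_bvec q i k) (to_bvec q i k - to_bvec p i k).
    by rewrite addrA subrK /to_bvec; lra.
  - exact: enorm_le_dim.
  - apply: le_trans (_ : _ <= `|L0| * (C * e)) _; last by rewrite mulrA ler_wpM2r // ltW.
    apply: le_trans (_ : _ <= `|L0| * bnorm (bsub (to_bvec q) y)) _.
      by rewrite ler_wpM2r ?bnorm_ge0 // ler_norm.
    by rewrite ler_wpM2l // bnorm_le_dimsum.
exists (L + 2 * K * L); first by rewrite ler_wpDr // !mulr_ge0 //; lra.
move=> x y u d xM yM uU d0 xy l.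
have Ld0 : 0 <= L * d by rewrite mulr_ge0 //; lra.
have KLd0 : 0 <= 2 * K * L * d by rewrite !mulr_ge0 //; lra.
rewrite mulrDl; have [dL|dL] := ltP d L^-1.
  apply: le_trans (_ : _ <= L * d) _; last by rewrite lerDl.
  have := HL (fun j => x (tag j) (tagged j)) (fun j => xM _ _) y u d uU d0 dL.
  by apply.
apply: le_trans (_ : _ <= 2 * K * L * d) _; last by rewrite lerDr.
apply: le_trans (_ : _ <= 2 * K) _.
  have := ler_normB (g x u l) (g y u l); have := HK x u xM uU l; have := HK y u yM uU l.
  by move=> *; lra.
rewrite -mulrA ler_peMr //; first by rewrite mulr_ge0 //; lra.
by rewrite mulrC -ler_pdivrMr ?div1r //; lra.
Qed.

End RhsBounds.

(** * Global solutions of the interconnection *)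

Section Existence.
Variables (R : realType) (n : nat) (N m : 'I_n -> nat).
Variable f : forall i : 'I_n, bvec R N -> ('I_(m i) -> R) -> ('I_(N i) -> R).
Arguments f : clear implicits.
Notation mu := (@lebesgue_measure R).
Notation rhs u := (fun s y => fun i => f i y (u s i)).
Hypothesis f_cont : forall i, rhs_continuous (f i).
Hypothesis f_lip : forall i, rhs_loc_lip (f i).
Implicit Types (u : R -> bvec R m) (x : R -> bvec R N).

(** [c] will be the clipping for the modified equation and the identity for the original one. *)
Lemma rhs_measurable (D : set R) x u (c : R -> R) i l : measurable D ->
  (forall a b, `|c a - c b| <= `|a - b|) ->
  (forall j k, measurable_fun D (fun s => x s j k)) ->
  (forall k, measurable_fun D (fun s => u s i k)) ->
  measurable_fun D (fun s => f i (fun j k => c (x s j k)) (u s i) l).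
Proof.
move=> mD c_lip mx mu_.
pose v s (j : state_index N + 'I_(m i)) :=
  match j with inl j => x s (tag j) (tagged j) | inr k => u s i k end.
pose G (q : state_index N + 'I_(m i) -> R) :=
  f i (fun j k => c (to_bvec (fun j => q (inl j)) j k)) (fun k => q (inr k)) l.
apply: (@measurable_fun_continuous_comp R _ D v G) => //.
  by case=> [[j k]|k]; [exact: mx|exact: mu_].
move=> p e e0.
pose xp : bvec R N := fun j k => c (to_bvec (fun j => p (inl j)) j k).
pose up : 'I_(m i) -> R := fun k => p (inr k).
have [d d0 Hd] := rhs_continuous_coord (@f_cont i) xp up e0.
exists d => // q qp; apply: Hd => [j k|k]; last exact: qp.
by apply: le_lt_trans (c_lip _ _) _; exact: qp.
Qed.

Variables (b : R -> R -> R) (g : R -> R).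
Hypothesis bKL : classKL b.
Hypothesis solution_bound : forall (T : R) u x, 0 <= T -> is_bLinf u ->
  is_bsol (rhs u) T x -> forall t : R, 0 <= t <= T ->
  bnorm (x t) <= b (bnorm (x 0)) t + g (blinf_norm u).

(* Solve the equation with the state clipped to a box just larger than the a priori bound
   [B]. Speeds are at most [K], so a solution bounded by [B] up to time [k / K] is unclipped up
   to [(k + 1) / K], whence again bounded by [B]. *)
Lemma bounded_input_solution u (U : R) (x0 : bvec R N) :
  (forall i l, measurable_fun [set: R] (fun t => u t i l)) ->
  (forall t i l, `|u t i l| <= U) ->
  exists x, x 0 = x0 /\ forall T : R, 0 <= T -> is_bsol (rhs u) T x.
Proof.
move=> mu_ uU.
have uL : is_bLinf u.
  split=> //; apply: le_lt_trans (ltry (dimsum R m * U)); apply: esup_le.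
  by apply: nearW => t; apply: bnorm_le_dimsum => i l; exact: uU.
pose B := b (bnorm x0) 0 + g (blinf_norm u).
(* The constant function solves the equation on the degenerate interval [[0, 0]], so the a priori
   bound itself yields this. *)
have x0B : bnorm x0 <= B.
  have := @solution_bound 0 u (fun=> x0) (lexx 0) uL; apply; last by rewrite lexx.
  move=> t tT i l; have -> : t = 0 by apply/le_anti; rewrite andbC.
  rewrite /I0t set_itv1 subrr integral_set1; split=> //.
  apply/integrableP; split; first exact: measurable_fun_set1.
  by rewrite integral_set1 ltry.
have B0 : 0 <= B by exact: le_trans (bnorm_ge0 _) x0B.
pose M := B + 1; have M0 : 0 <= M by rewrite /M; lra.
have /choice[K KP] : forall i, exists K, 1 <= K /\ forall (x : bvec R N) v,
    (forall i l, `|x i l| <= M) -> (forall l, `|v l| <= U) -> forall l, `|f i x v l| <= K.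
  by move=> i; have [K K1 HK] := rhs_bounded_on_box (@f_cont i) M U; exists K.
have /choice[L LP] : forall i, exists L, 1 <= L /\ forall (x y : bvec R N) v d,
    (forall i l, `|x i l| <= M) -> (forall i l, `|y i l| <= M) -> (forall l, `|v l| <= U) ->
    0 <= d -> (forall i l, `|x i l - y i l| <= d) ->
    forall l, `|f i x v l - f i y v l| <= L * d.
  by move=> i; have [L L1 HL] := rhs_lipschitz_on_box (@f_cont i) (@f_lip i) M U; exists L.
(* One constant for all blocks; the summand 1 keeps both at least 1 even without blocks. *)
pose Ks := 1 + \sum_i K i; pose Ls := 1 + \sum_i L i.
have K0 i : 0 <= K i by case: (KP i) => H _; exact: le_trans H.
have L0 i : 0 <= L i by case: (LP i) => H _; exact: le_trans H.
have KKs i : K i <= Ks.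
  by rewrite /Ks (bigD1 i) //= addrCA lerDl addr_ge0 // sumr_ge0.
have LLs i : L i <= Ls.
  by rewrite /Ls (bigD1 i) //= addrCA lerDl addr_ge0 // sumr_ge0.
have Ks1 : 1 <= Ks by rewrite lerDl sumr_ge0.
have Ls1 : 1 <= Ls by rewrite lerDl sumr_ge0.
have Ks0 : 0 < Ks by rewrite (lt_le_trans ltr01).
pose F s (q : state_index N -> R) (j : state_index N) : R :=
  f (tag j) (fun i l => clip M (to_bvec q i l)) (u s (tag j)) (tagged j).
have F_bounded s q j : `|F s q j| <= Ks.
  apply: le_trans (KKs (tag j)); have [_ H] := KP (tag j).
  by apply: H => // i l; exact: clip_bound.
have F_lip s p q d j : (forall k, `|p k - q k| <= d) -> `|F s p j - F s q j| <= Ls * d.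
  move=> pq; have d0 : 0 <= d by apply: le_trans (pq j); exact: normr_ge0.
  apply: le_trans (_ : _ <= L (tag j) * d) _; last by rewrite ler_wpM2r.
  have [_ H] := LP (tag j); apply: H => // i l.
  - exact: clip_bound.
  - exact: clip_bound.
  - by apply: le_trans (clip_lip _ _ _) _; exact: pq.
have F_meas (z : R -> state_index N -> R) :
    (forall j, measurable_fun [set: R] (fun s => z s j)) ->
    forall j, measurable_fun [set: R] (fun s => F s (z s) j).
  move=> mz j; apply: (@rhs_measurable _ (fun s => to_bvec (z s)) u (clip M)) => //.
  - exact: clip_lip.
  - by move=> i l; exact: mz.
have [z [z0 mz zE]] := picard_solution (fun j => x0 (tag j) (tagged j)) (ltW Ks0) Ls1
  F_bounded F_lip F_meas.
pose x t : bvec R N := to_bvec (z t).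
have x_0 : x 0 = x0.
  by apply/functional_extensionality_dep => i; apply/funext => l; rewrite /x /to_bvec z0.
have x_lip s t i l : 0 <= s -> s <= t -> `|x t i l - x s i l| <= Ks * (t - s).
  move=> s0 st; rewrite /x /to_bvec !zE ?(le_trans s0) // opprD addrACA subrr add0r.
  by apply: prim_lipschitz => //; [exact: ltW|exact: F_meas].
have unclipped T : 0 <= T -> (forall t i l, 0 <= t <= T -> `|x t i l| <= M) ->
    is_bsol (rhs u) T x.
  move=> T0 xM t /andP[t0 tT] i l; pose j : state_index N := existT _ i l.
  have iF : mu.-integrable (I0t t) (EFin \o (fun s => F s (z s) j)).
    exact: (bounded_integrable _ _ _ _ (F_meas z mz j) (fun s => F_bounded s (z s) j)).
  have FE s : I0t t s -> F s (z s) j = f i (x s) (u s i) l.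
    rewrite /I0t /= in_itv /= => /andP[s0 st]; rewrite /F /=; congr (f i _ _ _).
    apply/functional_extensionality_dep => i'; apply/funext => l'.
    by apply: clip_id; apply: xM; rewrite s0 (le_trans st).
  split.
    by apply: eq_integrable iF => [|s /[!inE] sI]; [exact: measurable_I0t|rewrite /= FE].
  rewrite x_0 [x t i l]zE // addrAC subrr add0r /prim /Rintegral fineK; last first.
    by apply: integrable_fin_num => //; exact: measurable_I0t.
  by apply: eq_integral => s /[!inE] sI; rewrite FE.
have stays (k : nat) : forall t, 0 <= t <= k%:R / Ks -> bnorm (x t) <= B.
  elim: k => [|k IH] t tk.
    have -> : t = 0 by apply/le_anti; move: tk; rewrite mul0r andbC.
    by rewrite x_0.
  have k0 : 0 <= k%:R / Ks by rewrite divr_ge0 // ltW.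
  have k1 : 0 <= k.+1%:R / Ks by rewrite divr_ge0 // ltW.
  have sol : is_bsol (rhs u) (k.+1%:R / Ks) x.
    apply: unclipped => // s i l /andP[s0 sk].
    have [sk'|/ltW sk'] := leP s (k%:R / Ks).
      apply: le_trans (coord_le_bnorm (x s) l) _; rewrite /M.
      by have := IH s; rewrite s0 sk' => /(_ isT); lra.
    have h1 : `|x (k%:R / Ks) i l| <= B.
      by apply: le_trans (coord_le_bnorm (x (k%:R / Ks)) l) _; apply: IH; rewrite k0 lexx.
    have h2 : `|x s i l - x (k%:R / Ks) i l| <= 1.
      apply: le_trans (x_lip _ _ _ _ k0 sk') _.
      rewrite mulrBr mulrCA divff ?gt_eqF // mulr1 lerBlDr nat1r -ler_pdivlMl //.
      by rewrite mulrC.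
    have := ler_normD (x s i l - x (k%:R / Ks) i l) (x (k%:R / Ks) i l).
    by rewrite subrK /M; lra.
  apply: le_trans (solution_bound k1 uL sol tk) _; rewrite /B lerD2r x_0.
  have [_ /(_ _ (bnorm_ge0 x0))[H _]] := bKL; apply: H => //.
  by case/andP : tk.
exists x; split=> // T T0; apply: unclipped => // t i l /andP[t0 tT].
apply: le_trans (coord_le_bnorm (x t) l) _; rewrite /M.
have tK : 0 <= t * Ks by rewrite mulr_ge0 // ltW.
have := stays (Num.bound (t * Ks)) t; rewrite t0 ler_pdivlMr //.
by rewrite (ltW (archi_boundP tK)) => /(_ isT); lra.
Qed.

(** Clipping the input at its essential supremum changes it only on a null set and makes it bounded
    everywhere; the integral equation does not see the change. *)
Lemma global_solution u (x0 : bvec R N) : is_bLinf u ->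
  exists x, x 0 = x0 /\ forall T : R, 0 <= T -> is_bsol (rhs u) T x.
Proof.
move=> [mu_ uy]; pose U := blinf_norm u.
have U0 : 0 <= U by exact: blinf_norm_ge0.
pose v t : bvec R m := fun i l => clip U (u t i l).
have [||x [x_0 xs]] := @bounded_input_solution v U x0.
- move=> i l; apply: (@measurable_fun_continuous_comp R 'I_1 setT (fun t _ => u t i l) (fun q => clip U (q ord0))) => //.
  move=> p e e0; exists e => // q qp; apply: le_lt_trans (clip_lip _ _ _) _; exact: qp.
- by move=> t i l; exact: clip_bound.
exists x; split=> // T T0 t tT i l; have [ix xE] := xs T T0 t tT i l.
have vu : \forall s \ae mu, v s = u s.
  have : \forall s \ae mu, bnorm (u s) <= U.
    by apply: le_fine_esup => // s; exact: bnorm_ge0.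
  apply: (@filterS _ _ (ae_filter_ringOfSetsType mu)) => s us.
  apply/functional_extensionality_dep => j; apply/funext => k.
  by apply: clip_id; exact: le_trans (coord_le_bnorm (u s) k) us.
have t0 : 0 <= t by case/andP : tT.
(* Almost everywhere equality transfers integrals between measurable integrands, so measurability
   along the original input is shown directly. *)
have m_u : measurable_fun (I0t t) (fun s => (f i (x s) (u s i) l)%:E).
  apply/measurable_EFinP.
  apply: (@rhs_measurable _ x u id) => //; first exact: measurable_I0t.
    move=> j k; apply: (@primitive_measurable R t (fun s => f j (x s) (v s j) k)) => //.
    by move=> r rt; exact: (xs t t0).
  by move=> k; exact: measurable_funTS.
have m_v : measurable_fun (I0t t) (fun s => (f i (x s) (v s i) l)%:E).
  by case/integrableP : ix.
have aeq : ae_eq mu (I0t t) (fun s => (f i (x s) (v s i) l)%:E) (fun s => (f i (x s) (u s i) l)%:E).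
  by move: vu; apply: (@filterS _ _ (ae_filter_ringOfSetsType mu)) => s -> _.
split; last by rewrite xE; apply: ae_eq_integral => //; exact: measurable_I0t.
apply/integrableP; split => //; case/integrableP : ix => _; apply: le_lt_trans.
rewrite le_eqVlt; apply/orP; left; apply/eqP; apply: ae_eq_integral.
- exact: measurable_I0t.
- exact: measurableT_comp.
- exact: measurableT_comp.
- by move: vu; apply: (@filterS _ _ (ae_filter_ringOfSetsType mu)) => s -> _.
Qed.

End Existence.

Theorem theorem3 (R : realType) (n : nat) (N m : 'I_n -> nat)
    (f : forall i : 'I_n, bvec R N -> ('I_(m i) -> R) -> ('I_(N i) -> R))
    (IS : {set 'I_n})
    (beta : 'I_n -> R -> R -> R) (gam : 'I_n -> 'I_n -> R -> R)
    (gamu : 'I_n -> R -> R) :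
  (forall i : 'I_n, rhs_continuous (f i)) ->
  (forall i : 'I_n, rhs_loc_lip (f i)) ->
  (forall i : 'I_n, classKL (beta i)) ->
  (forall i j : 'I_n, classKinf0 (gam i j)) ->
  (forall (i : 'I_n) (s : R), gam i i s = 0) ->
  (forall i : 'I_n, classKinf0 (gamu i)) ->
  (forall i : 'I_n, subsystem_ISS IS f i (beta i) (gam i) (gamu i)) ->
  (exists alpha : R -> R, classKinf alpha /\
     forall s : 'I_n -> R, (forall i, 0 <= s i) -> (exists i, s i != 0) ->
       exists i, Gam IS gam (Dalpha IS alpha s) i < s i) ->
  exists (betaS : R -> R -> R) (gamS : R -> R),
    classKL betaS /\ classK gamS /\
    forall (u : R -> bvec R m) (x0 : bvec R N), is_bLinf u ->
      (exists x : R -> bvec R N, x 0 = x0 /\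
         forall T : R, 0 <= T -> is_bsol (fun s y => fun i => f i y (u s i)) T x) /\
      (forall (T : R) (x : R -> bvec R N), 0 <= T -> x 0 = x0 ->
         is_bsol (fun s y => fun i => f i y (u s i)) T x ->
         forall t : R, 0 <= t <= T ->
           bnorm (x t) <= betaS (bnorm x0) t + gamS (blinf_norm u)).
Proof.
move=> f_cont f_lip betaK gamK _ gamuK iss [alpha [alphaK small_gain]].
have [b [g [bKL [gK bound]]]] :=
  interconnection_ISS gamK gamuK betaK alphaK small_gain iss.
exists b, g; do 2 split => //; move=> u x0 uL; split.
  exact: (global_solution f_cont f_lip bKL bound x0 uL).
by move=> T x T0 <- xs; exact: bound.
Qed.
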